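(* Let $n\ge2$, $R>0$ and $S_R:=\{x=(x',x_n): x'\in\mathbb{R}^{n-1},\ 0<x_n<2R\}$. For all $u\in C_c^\infty(S_R)$, all $s\ge 1$ and all $\gamma>1$, $$\int_{S_R}\frac{|\nabla u|}{d^{s-1}}\,dx\ \ge\ (s-1)\int_{S_R}\frac{|u|}{d^s}\,dx+\frac{C}{R^{s-1}}\int_{S_R}\frac{|u|}{d}\,X^\gamma\!\Big(\frac{d}{R}\Big)\,dx$$ holds with a constant $C\ge\gamma-1$. The last term is optimal in the sense that if $\gamma=1$ there is no positive constant $C$ such that this inequality holds for all $u\in C_c^\infty(S_R)$.
   Context: $d(x):=\operatorname{dist}(x,\mathbb{R}^n\setminus S_R)$, and $X(t):=(1-\log t)^{-1}$ for $t\in(0,1]$. *)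

(* Defs.v *)
From HB Require Import structures.
From mathcomp Require Import all_boot all_order all_algebra.
From mathcomp Require Import all_classical all_reals all_analysis.
Set Implicit Arguments. Unset Strict Implicit. Unset Printing Implicit Defensive.
Import Order.TTheory GRing.Theory Num.Theory.
Import numFieldNormedType.Exports.
Local Open Scope classical_set_scope.
Local Open Scope ring_scope.

Section Defs.
Variable R : realType.

Definition lastc (n : nat) : 'rV[R]_n -> R :=
  match n return 'rV[R]_n -> R with
  | 0 => fun _ => 0
  | k.+1 => fun x => x 0 ord_max
  end.

Definition strip (n : nat) (r : R) : set 'rV[R]_n :=
  [set x | 0 < lastc x < 2 * r].

Definition enorm (n : nat) (v : 'rV[R]_n) : R :=
  Num.sqrt (\sum_(i < n) v 0 i ^+ 2).

Definition edist (n : nat) (x : 'rV[R]_n) (A : set 'rV[R]_n) : R :=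
  inf [set enorm (x - y) | y in A].

Definition dS (n : nat) (r : R) (x : 'rV[R]_n) : R := edist x (~` @strip n r).

Definition Xf (t : R) : R := (1 - ln t)^-1.

Definition evec (n : nat) (i : 'I_n) : 'rV[R]_n := \row_j (i == j)%:R.
Definition partial (n : nat) (i : 'I_n) (u : 'rV[R]_n -> R) (x : 'rV[R]_n) : R :=
  'D_(evec i) u x.

Definition grad_norm (n : nat) (u : 'rV[R]_n -> R) (x : 'rV[R]_n) : R :=
  Num.sqrt (\sum_(i < n) (partial i u x) ^+ 2).

Fixpoint iter_D (n : nat) (vs : seq 'rV[R]_n) (u : 'rV[R]_n -> R) : 'rV[R]_n -> R :=
  match vs with
  | [::] => u
  | v :: vs' => fun x => 'D_v (iter_D vs' u) x
  end.

Definition smooth (n : nat) (u : 'rV[R]_n -> R) : Prop :=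
  forall (vs : seq 'rV[R]_n) (x : 'rV[R]_n), differentiable (iter_D vs u) x.

Definition Cc_inf (n : nat) (Om : set 'rV[R]_n) (u : 'rV[R]_n -> R) : Prop :=
  smooth u /\ compact (closure [set x | u x != 0]) /\
  closure [set x | u x != 0] `<=` Om.

(* Lebesgue integral over R^n of a (nonnegative) extended-real function,
   written as the iterated integral dx_1 dx_2 ... dx_n (Tonelli). *)
Fixpoint lebn (n : nat) : ('rV[R]_n -> \bar R) -> \bar R :=
  match n return ('rV[R]_n -> \bar R) -> \bar R with
  | 0 => fun f => f 0
  | k.+1 => fun f =>
      (\int[@lebesgue_measure R]_t
         lebn (fun y : 'rV[R]_k => f (row_mx (\row_(j < 1) t) y)))%E
  end.

Definition lebn_on (n : nat) (A : set 'rV[R]_n) (f : 'rV[R]_n -> \bar R) : \bar R :=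
  lebn (fun x => if x \in A then f x else 0%E).

End Defs.
Arguments strip {R} n r.

(* Main.v *)
(* Inequality.  The last coordinate is integrated first, so it suffices to treat
   t = x_n on (0, 2r) with d = min(t, 2r - t); superadditivity of the lower
   integral passes the one-dimensional inequality to n dimensions.  On (0, r] the
   weight w(t) = t^(1-s) - r^(1-s) X(t/r)^(gamma-1) satisfies 0 <= w <= t^(1-s),
   w(r) = 0 and -w' = (s-1) t^(-s) + (gamma-1) r^(1-s) X(t/r)^gamma / t, and
   integrating by parts |phi| <= int |phi'| against w gives the inequality with
   C = gamma - 1; the other half of the strip is its mirror image.

   Optimality.  Take u(x) = b_L(x_1) ... b_L(x_{n-1}) f_del(x_n), where f_del is
   symmetric, increasing on (0, r), bounded by 1, and at least e^(-2) between
   2 del and 2r - 2 del.  In the x_n variable the Hardy difference equals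
   2 f_del(r) r^(1-s), which stays bounded, while int f_del X(d/r) / d grows like
   log(1 - log(2 del/r)).  Fix del with the latter large enough; letting the width
   L of the other factors tend to infinity makes the tangential derivatives
   negligible. *)
Require Import Defs.
From HB Require Import structures.
From mathcomp Require Import all_boot all_order all_algebra.
From mathcomp Require Import all_classical all_reals all_analysis.
From mathcomp Require Import measurable_realfun ring lra.
Import Order.TTheory GRing.Theory Num.Theory.
Import numFieldNormedType.Exports.
Local Open Scope classical_set_scope.
Local Open Scope ring_scope.
Set Implicit Arguments.
Unset Strict Implicit.
Unset Printing Implicit Defensive.

(** * Iterated lower integrals *)

Section LowerIntegral.
Context d (T : measurableType d) (R : realType) (mu : {measure set T -> \bar R}).
Local Open Scope ereal_scope.
Import HBNNSimple.

Lemma le_integralT (f g : T -> \bar R) :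
  (forall x, 0 <= f x) -> (forall x, f x <= g x) ->
  \int[mu]_x f x <= \int[mu]_x g x.
Proof.
move=> f0 fg; rewrite !ge0_integralTE//; last by move=> x; exact: le_trans (fg x).
apply: ge_ereal_sup => _ [h /= hf <-]; apply: ereal_sup_ubound; exists h => //=.
by move=> x; exact: le_trans (fg x).
Qed.

(** The suprema are taken one at a time, the other summand being moved to the right-hand side, which
    is legitimate when it is finite. An infinite summand forces [c = +oo]. [B 0] gives
    [ereal_sup B >= 0], which excludes an indeterminate sum. *)
Lemma ereal_sup_addle (A B : set (\bar R)) c : B 0 ->
  (forall x, A x -> 0 <= x) ->
  (forall x y, A x -> B y -> x + y <= c) ->
  ereal_sup A + ereal_sup B <= c.
Proof.
move=> B0 A0 AB.
have AC x : A x -> x + ereal_sup B <= c.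
  move=> Ax; have [xoo|xfin] := eqVneq x +oo.
    have := AB _ _ Ax B0; rewrite adde0 xoo leye_eq => /eqP ->.
    by rewrite leey.
  have xf : x \is a fin_num by rewrite ge0_fin_numE ?A0// ltey.
  rewrite addeC -leeBrDr//; apply: ge_ereal_sup => y By.
  by rewrite leeBrDr// addeC; exact: AB.
have [->|/set0P A0'] := eqVneq A set0; first by rewrite ereal_sup0 leNye.
have supB0 : 0 <= ereal_sup B by exact: ereal_sup_ubound.
have [boo|bfin] := eqVneq (ereal_sup B) +oo.
  have [x Ax] := A0'; have := AC _ Ax.
  rewrite boo addey; last by rewrite -ltNye (lt_le_trans _ (A0 _ Ax)).
  by rewrite leye_eq => /eqP ->; rewrite leey.
have bf : ereal_sup B \is a fin_num by rewrite ge0_fin_numE ?ltey.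
rewrite -leeBrDr//; apply: ge_ereal_sup => x Ax.
by rewrite leeBrDr//; exact: AC.
Qed.

(* No measurability is needed: the integral of a nonnegative function is the
   supremum of the integrals of the simple functions below it. *)
Lemma integral_superadd (f g : T -> \bar R) :
  (forall x, 0 <= f x) -> (forall x, 0 <= g x) ->
  \int[mu]_x f x + \int[mu]_x g x <= \int[mu]_x (f x + g x).
Proof.
move=> f0 g0; rewrite !ge0_integralTE//; last by move=> x; exact: adde_ge0.
apply: ereal_sup_addle.
- by exists nnsfun0 => //=; exact: sintegral0.
- by move=> _ [h _ <-]; exact: sintegral_ge0.
- move=> _ _ [h /= hf <-] [k /= kg <-]; apply: ereal_sup_ubound.
  exists (add_nnsfun h k) => /=; last by rewrite -sintegralD.
  by move=> x; rewrite EFinD leeD.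
Qed.

(** A simple function below [f], scaled by [k], is a simple function below [k f]. The case [k = 0]
    is separate because the argument divides by [k]. *)
Lemma le_integralZ (k : R) (f : T -> \bar R) : (0 <= k)%R ->
  (forall x, 0 <= f x) ->
  k%:E * \int[mu]_x f x <= \int[mu]_x (k%:E * f x).
Proof.
move=> k0 f0.
have kf0 x : 0 <= k%:E * f x by rewrite mule_ge0.
have [->|kN0] := eqVneq k 0%R; first by rewrite mul0e; apply: integral_ge0 => x _; rewrite mul0e.
have kp : (0 < k)%R by rewrite lt_neqAle eq_sym kN0.
rewrite -lee_pdivlMl// !ge0_integralTE//; apply: ge_ereal_sup => _ [h /= hf <-].
rewrite lee_pdivlMl//; apply: ereal_sup_ubound; exists (scale_nnsfun h k0) => /=.
  by move=> x; rewrite EFinM lee_pmul2l.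
by rewrite -sintegralrM.
Qed.

Lemma integral_comb_le (a b : R) (f g h : T -> \bar R) :
  (0 <= a)%R -> (0 <= b)%R ->
  (forall x, 0 <= f x) -> (forall x, 0 <= g x) ->
  (forall x, a%:E * f x + b%:E * g x <= h x) ->
  a%:E * \int[mu]_x f x + b%:E * \int[mu]_x g x <= \int[mu]_x h x.
Proof.
move=> a0 b0 f0 g0 fgh.
have af0 x : 0 <= a%:E * f x by rewrite mule_ge0.
have bg0 x : 0 <= b%:E * g x by rewrite mule_ge0.
apply: (le_trans (leeD (le_integralZ a0 f0) (le_integralZ b0 g0))).
apply: (le_trans (integral_superadd af0 bg0)); apply: le_integralT => // x.
exact: adde_ge0.
Qed.

End LowerIntegral.

(** * Iterated integrals and reduction to the last coordinate *)

Section Lebn.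
Variable R : realType.
Local Open Scope ereal_scope.

Lemma lebnS n (f : 'rV[R]_n.+1 -> \bar R) :
  lebn f = \int[@lebesgue_measure R]_t lebn (fun y => f (row_mx (\row_(j < 1) t) y)).
Proof. by []. Qed.

Lemma lebn_ge0 n (f : 'rV[R]_n -> \bar R) : (forall x, 0 <= f x) -> 0 <= lebn f.
Proof. by elim: n f => [|n IH] f f0 //=; apply: integral_ge0 => t _; exact: IH. Qed.

Lemma le_lebn n (f g : 'rV[R]_n -> \bar R) :
  (forall x, 0 <= f x) -> (forall x, f x <= g x) -> lebn f <= lebn g.
Proof.
elim: n f g => [|n IH] f g f0 fg //=.
apply: le_integralT => t; first by apply: lebn_ge0.
exact: IH.
Qed.

Definition setc n (i : 'I_n) (x : 'rV[R]_n) (t : R) : 'rV[R]_n :=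
  \row_j if j == i then t else x 0%R j.

Lemma setc_row_mx n (t : R) (y : 'rV[R]_n.+1) (s : R) :
  setc ord_max (row_mx (\row_(j < 1) t) y : 'rV[R]_n.+2) s
  = row_mx (\row_(j < 1) t) (setc ord_max y s).
Proof.
apply/rowP => j; rewrite !mxE; case: splitP => k /= jk.
  rewrite ifF ?mxE//; last by apply/eqP => /(congr1 val) /=; rewrite jk; case: k {jk} => -[].
by rewrite !mxE -!val_eqE /= jk add1n eqSS.
Qed.

(** The last coordinate is the innermost variable of [lebn], so the hypothesis is the inequality for
    the innermost integral with the other coordinates frozen. Each outer integration preserves it by
    [integral_comb_le], which asks for no measurability of the partial integrals. *)
Lemma lebn_comb_le n (a b : R) (f g h : 'rV[R]_n.+1 -> \bar R) :
  (0 <= a)%R -> (0 <= b)%R ->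
  (forall x, 0 <= f x) -> (forall x, 0 <= g x) -> (forall x, 0 <= h x) ->
  (forall x, a%:E * \int[@lebesgue_measure R]_t f (setc ord_max x t)
     + b%:E * \int[@lebesgue_measure R]_t g (setc ord_max x t)
     <= \int[@lebesgue_measure R]_t h (setc ord_max x t)) ->
  a%:E * lebn f + b%:E * lebn g <= lebn h.
Proof.
move=> a0 b0; elim: n f g h => [|n IH] f g h f0 g0 h0 fgh.
  (* In dimension one [setc] overwrites the only coordinate, so the hypothesis may be read at the
     base point 0. *)
  have E t : setc ord_max (0%R : 'rV[R]_1) t = row_mx (\row_(j < 1) t) (0%R : 'rV[R]_0).
    apply/rowP => j; rewrite !mxE; case: splitP => k /= jk; last by case: k jk.
    by rewrite mxE ifT//; apply/eqP/val_inj; rewrite /= jk; case: k {jk} => -[].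
  have := fgh 0%R; rewrite /=.
  by under eq_integral do rewrite E; under [X in _ + _ * X <= _]eq_integral do rewrite E;
     under [X in _ <= X]eq_integral do rewrite E.
rewrite (lebnS f) (lebnS g) (lebnS h).
apply: integral_comb_le => // t; [exact: lebn_ge0..|].
by apply: IH => // y; have := fgh (row_mx (\row_(j < 1) t) y);
   under eq_integral do rewrite setc_row_mx;
   under [X in _ + _ * X <= _]eq_integral do rewrite setc_row_mx;
   under [X in _ <= X]eq_integral do rewrite setc_row_mx.
Qed.

End Lebn.

(** * Weighted Hardy inequality on an interval *)

Section OneDim.
Variable R : realType.
Notation mu := (@lebesgue_measure R).

Lemma is_derive_continuous (f : R -> R) (x df : R) :
  is_derive x 1 f df -> {for x, continuous f}.
Proof. by move=> [/derivable1_diffP/differentiable_continuous]. Qed.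

Lemma continuous_norm_fun (f : R -> R) (t : R) :
  {for t, continuous f} -> {for t, continuous (fun x => `|f x|)}.
Proof.
by move=> cf; apply: (@continuous_comp _ _ _ f Num.norm) => //; exact: norm_continuous.
Qed.

(** * Calculus on a segment *)

Section Segment.
Variables (a b : R).

Lemma continuous_within_segment (f : R -> R) :
  (forall t, a <= t <= b -> {for t, continuous f}) ->
  {within `[a, b], continuous f}.
Proof.
by move=> cf; apply: continuous_in_subspaceT => t; rewrite inE/= in_itv/= => /cf.
Qed.

Lemma is_derive_oo_LRcontinuous (F f : R -> R) :
  (forall t, a <= t <= b -> is_derive t 1 F (f t)) -> a <= b ->
  derivable_oo_LRcontinuous F a b.
Proof.
move=> dF ab; split.
- move=> t; rewrite in_itv/= => /andP[at_ tb].
  by have [] := dF t; rewrite ?(ltW at_) ?(ltW tb).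
- by apply: cvg_at_right_filter; apply: (is_derive_continuous (dF a _)); rewrite lexx.
- by apply: cvg_at_left_filter; apply: (is_derive_continuous (dF b _)); rewrite lexx andbT.
Qed.

Lemma is_derive_oo_derive1 (F f : R -> R) :
  (forall t, a <= t <= b -> is_derive t 1 F (f t)) -> {in `]a, b[, derive1 F =1 f}.
Proof.
move=> dF t; rewrite in_itv/= => /andP[at_ tb].
by have [] := dF t; rewrite ?(ltW at_) ?(ltW tb)// derive1E.
Qed.

Lemma integral_derive (F f : R -> R) : a < b ->
  (forall t, a <= t <= b -> is_derive t 1 F (f t)) ->
  (forall t, a <= t <= b -> {for t, continuous f}) ->
  (\int[mu]_(t in `[a, b]) (f t)%:E = (F b - F a)%:E)%E.
Proof.
move=> ab dF cf; rewrite EFinB; apply: continuous_FTC2 => //.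
- exact: continuous_within_segment.
- by apply: is_derive_oo_LRcontinuous dF _; exact: ltW.
- exact: is_derive_oo_derive1.
Qed.

Lemma measurable_fun_segment (f : R -> R) :
  (forall t, a <= t <= b -> {for t, continuous f}) ->
  measurable_fun (`[a, b]%classic : set R) f.
Proof.
move=> cf; apply: subspace_continuous_measurable_fun => //.
exact: continuous_within_segment.
Qed.

Lemma is_derive_le_le (F G f g : R -> R) : a <= b ->
  (forall t, a <= t <= b -> is_derive t 1 F (f t)) ->
  (forall t, a <= t <= b -> is_derive t 1 G (g t)) ->
  (forall t, a <= t <= b -> f t <= g t) ->
  F b - F a <= G b - G a.
Proof.
move=> ab dF dG fg.
have dH t : a <= t <= b -> is_derive t 1 (G - F) (g t - f t).
  by move=> tab; apply: is_deriveB; [exact: dG|exact: dF].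
suff : (G - F) a <= (G - F) b by rewrite !fctE; lra.
apply: (@ger0_derive1_le_cc R (G - F) a b); rewrite ?in_itv/= ?lexx ?ab//.
- by move=> t; rewrite in_itv/= => /andP[at_ tb]; have [] := dH t; rewrite ?(ltW at_) ?(ltW tb).
- move=> t tab; rewrite (is_derive_oo_derive1 dH)//.
  by move: tab; rewrite in_itv/= => /andP[at_ tb]; rewrite subr_ge0 fg// ?(ltW at_) ?(ltW tb).
- by apply: continuous_within_segment => t /dH /is_derive_continuous.
Qed.

End Segment.

(** [Phi] is the integral of [|dphi|] from [a], and [-|dphi| <= dphi <= |dphi|] gives
    [|phi| <= Phi]. It is a differentiable substitute for [|phi|], which may have corners at the
    zeros of [phi]. *)
Lemma variation_majorant (a b : R) (phi dphi : R -> R) : a <= b ->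
  (forall t : R, is_derive t 1 phi (dphi t)) -> continuous dphi -> phi a = 0 ->
  exists Phi : R -> R, [/\ Phi a = 0,
    forall t, a <= t <= b -> is_derive t 1 Phi `|dphi t| &
    forall t, a <= t <= b -> `|phi t| <= Phi t].
Proof.
move=> ab dp cdp pa.
have cn t : {for t, continuous (fun x => `|dphi x|)}.
  by apply: continuous_norm_fun; exact: cdp.
(* Starting the integral at [a - 1] makes [a] an interior point, so [P] has a two-sided derivative
   there as well. *)
pose P t := (\int[mu]_(x in `[a - 1, t]) `|dphi x|)%R.
have dP t : a <= t <= b -> is_derive t 1 P `|dphi t|.
  move=> /andP[at_ tb].
  have [||||dP eP] := @continuous_FTC1_closed R (fun x => `|dphi x|) (a - 1) t (b + 1).
  - lra.
  - apply: continuous_compact_integrable; first exact: segment_compact.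
    by apply: continuous_subspaceT => x; exact: cn.
  - lra.
  - exact: cn.
  - by apply: DeriveDef; [exact: dP|rewrite -derive1E; exact: eP].
exists (fun t => P t - P a); split; first by rewrite subrr.
- move=> t /dP dPt; have := @is_deriveB _ _ _ P (cst (P a)) t 1 `|dphi t| 0 dPt (is_derive_cst _ _ _).
  by rewrite subr0.
- move=> t /andP[at_ tb]; rewrite ler_norml.
  have dPt x : a <= x <= t -> is_derive x 1 P `|dphi x|.
    by move=> /andP[ax xt]; apply: dP; rewrite ax (le_trans xt).
  apply/andP; split.
    have H x : a <= x <= t -> - dphi x <= `|dphi x| by rewrite -normrN ler_norm.
    have := @is_derive_le_le a t (- phi) P _ _ at_ (fun x _ => is_deriveN (dp x)) dPt H.
    by rewrite [(- phi) t]/GRing.opp [(- phi) a]/GRing.opp /= pa oppr0 subr0 lerNl.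
  have := @is_derive_le_le a t phi P _ _ at_ (fun x _ => dp x) dPt (fun x _ => ler_norm _).
  by rewrite pa subr0.
Qed.

(* Integration by parts, with the majorant of [variation_majorant] in place of
   the non-differentiable [|phi|]. *)
Lemma weighted_hardy_left (a r : R) (phi dphi V W : R -> R) : a < r ->
  (forall t : R, is_derive t 1 phi (dphi t)) -> continuous dphi -> phi a = 0 ->
  (forall t, a <= t <= r -> is_derive t 1 W (- V t)) -> W r = 0 ->
  (forall t, a <= t <= r -> {for t, continuous V}) ->
  (forall t, a <= t <= r -> 0 <= V t) ->
  (\int[mu]_(t in `[a, r]) (`|phi t| * V t)%:E
     <= \int[mu]_(t in `[a, r]) (`|dphi t| * W t)%:E)%E.
Proof.
move=> ar dp cdp pa dW Wr cV V0.
have [Phi [Phia dPhi pPhi]] := variation_majorant (ltW ar) dp cdp pa.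
have cPhi t : a <= t <= r -> {for t, continuous Phi} by move=> /dPhi /is_derive_continuous.
have cp t : {for t, continuous (fun x => `|phi x|)}.
  by apply: continuous_norm_fun; exact: is_derive_continuous.
have cdn t : {for t, continuous (fun x => `|dphi x|)}.
  by apply: continuous_norm_fun; exact: cdp.
apply: (@le_trans _ _ (\int[mu]_(t in `[a, r]) (Phi t * V t)%:E)%E).
  apply: ge0_le_integral => //=.
  - by move=> t; rewrite /= in_itv/= => tar; rewrite lee_fin mulr_ge0// V0.
  - by apply/measurable_EFinP; apply: measurable_fun_segment => t tar;
    apply: continuousM; [exact: cp|exact: cV].
  - by apply/measurable_EFinP; apply: measurable_fun_segment => t tar;
    apply: continuousM; [exact: cPhi|exact: cV].
  - by move=> t; rewrite /= in_itv/= => tar; rewrite lee_fin ler_wpM2r ?V0 ?pPhi.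
(* Both boundary terms vanish: [Phi] is zero at [a] and [W] is zero at [r]. *)
have := @integration_by_parts R Phi W (fun t => `|dphi t|) (fun t => - V t) a r ar.
rewrite Wr Phia mulr0 mul0r subr0 sub0e => IBP.
have {}IBP : (\int[mu]_(t in `[a, r]) (Phi t * - V t)%:E =
   - \int[mu]_(t in `[a, r]) (`|dphi t| * W t)%:E)%E.
  apply: IBP.
  - by apply: continuous_within_segment => t _; exact: cdn.
  - by apply: is_derive_oo_LRcontinuous dPhi _; exact: ltW.
  - exact: is_derive_oo_derive1.
  - by apply: continuous_within_segment => t tar; apply: continuousN; exact: cV.
  - by apply: is_derive_oo_LRcontinuous dW _; exact: ltW.
  - exact: is_derive_oo_derive1.
rewrite -[leRHS]oppeK -IBP.
under [X in (_ <= - X)%E]eq_integral do rewrite mulrN EFinN.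
rewrite integral_ge0N ?oppeK// => t; rewrite /= in_itv/= => tar.
by rewrite lee_fin mulr_ge0 ?V0// (le_trans _ (pPhi _ tar)).
Qed.

(** * Folding a symmetric interval at its midpoint *)

Lemma is_derive_reflection (c t : R) : is_derive t 1 (fun t => c - t) (-1).
Proof.
have := @is_deriveB _ _ _ (cst c) id t 1 0 1 (is_derive_cst _ _ _) (is_derive_id _ _).
by rewrite sub0r.
Qed.

(** The interval is cut at its midpoint [r], and the right half is mapped onto the left one by
    [t -> 2r - t]. *)
Lemma integral_fold (a r : R) (f : R -> R) : a < r ->
  (forall t, a <= t <= 2 * r - a -> 0 <= f t) ->
  (forall t, a <= t <= 2 * r - a -> {for t, continuous f}) ->
  (\int[mu]_(t in `[a, (2 * r - a)%R]) (f t)%:E =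
   \int[mu]_(t in `[a, r]) (f t)%:E + \int[mu]_(t in `[a, r]) (f (2 * r - t))%:E)%E.
Proof.
move=> ar fge0 cf.
have cf2 : measurable_fun (`[a, (2 * r - a)]%classic : set R) (fun t => (f t)%:E).
  by apply/measurable_EFinP; exact: measurable_fun_segment.
have -> : (`[a, (2 * r - a)]%classic : set R) = `[a, r]%classic `|` `]r, (2 * r - a)]%classic.
  by apply: itv_bndbnd_setU; rewrite bnd_simp; lra.
rewrite ge0_integral_setU//=; first last.
- apply/disj_setPS => t [] /=; rewrite !in_itv/= => /andP[_ tr] /andP[]; lra.
- by move=> t [] /=; rewrite !in_itv/= => /andP[at_ tb]; rewrite lee_fin fge0//; lra.
- rewrite -itv_bndbnd_setU// bnd_simp; lra.
congr (_ + _)%E.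
rewrite integral_itv_obnd_cbnd; last first.
  by apply: measurable_funS cf2 => //=; apply: subset_itvr; rewrite bnd_simp ltW.
have := @integration_by_substitution_decreasing R (fun t => 2 * r - t) f a r (ltW ar).
have -> : 2 * r - r = r by ring.
have dF := is_derive_reflection (2 * r).
have -> : derive1 (fun t => 2 * r - t) = cst (-1).
  by apply/funext => t; rewrite derive1E; have [_ ->] := dF t.
move=> ->.
- by apply: eq_integral => t _; rewrite !fctE /= opprK mulr1.
- by move=> x y _ _ xy; lra.
- by move=> ? _; exact: cvg_cst.
- exact: is_cvg_cst.
- exact: is_cvg_cst.
- by apply: is_derive_oo_LRcontinuous (fun t _ => dF t) _; exact: ltW.
- by apply: continuous_within_segment => t trb; apply: cf; lra.
Qed.

(** On [[0, 2r]] this is the distance to the nearer end; outside it is negative. *)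
Definition tent (r t : R) : R := Num.min t (2 * r - t).

Lemma tent_left (r t : R) : t <= r -> tent r t = t.
Proof. by move=> tr; rewrite /tent; apply/min_idPl; lra. Qed.

Lemma tent_sym (r t : R) : tent r (2 * r - t) = tent r t.
Proof. by rewrite /tent minC; congr Num.min; ring. Qed.

Lemma tent_bounds (a r t : R) : a <= t <= 2 * r - a -> a <= tent r t <= r.
Proof. by move=> /andP[at_ tb]; rewrite /tent le_min ge_min; lra. Qed.

Lemma continuous_tent (r : R) : continuous (tent r).
Proof.
move=> t.
apply: (@continuous_min _ _ (id : R -> R^o) (fun t : R => 2 * r - t : R^o)); first exact: cvg_id.
by apply: cvgB; [exact: cvg_cst|exact: cvg_id].
Qed.

Lemma integral_fold_tent (a r : R) (f V : R -> R) : a < r ->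
  (forall t, a <= t <= 2 * r - a -> 0 <= f t) ->
  (forall t, {for t, continuous f}) ->
  (forall t, a <= t <= r -> 0 <= V t) ->
  (forall t, a <= t <= r -> {for t, continuous V}) ->
  (\int[mu]_(t in `[a, (2 * r - a)%R]) (f t * V (tent r t))%:E =
   \int[mu]_(t in `[a, r]) (f t * V t)%:E +
   \int[mu]_(t in `[a, r]) (f (2 * r - t) * V t)%:E)%E.
Proof.
move=> ar f0 cf V0 cV; rewrite integral_fold//.
- congr (_ + _)%E; apply: eq_integral => t; rewrite inE/= in_itv/= => /andP[_ tr].
    by rewrite tent_left.
  by rewrite tent_sym tent_left.
- by move=> t tab; rewrite mulr_ge0 ?f0 ?V0// tent_bounds.
- move=> t tab; apply: continuousM; first exact: cf.
  by apply: continuous_comp; [exact: continuous_tent|apply: cV; exact: tent_bounds].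
Qed.

(** After folding, the left-half inequality is applied to [phi] and to its reflection [phi(2r - t)],
    whose derivative differs by a sign that the absolute value absorbs. *)
Lemma weighted_hardy (a r : R) (phi dphi V W : R -> R) : a < r ->
  (forall t : R, is_derive t 1 phi (dphi t)) -> continuous dphi ->
  phi a = 0 -> phi (2 * r - a) = 0 ->
  (forall t, a <= t <= r -> is_derive t 1 W (- V t)) -> W r = 0 ->
  (forall t, a <= t <= r -> {for t, continuous V}) ->
  (forall t, a <= t <= r -> 0 <= V t) ->
  (\int[mu]_(t in `[a, (2 * r - a)%R]) (`|phi t| * V (tent r t))%:E
     <= \int[mu]_(t in `[a, (2 * r - a)%R]) (`|dphi t| * W (tent r t))%:E)%E.
Proof.
move=> ar dp cdp pa pb dW Wr cV V0.
(* [W] has derivative [- V <= 0], so it is nonincreasing and stays above [W r = 0]. *)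
have W0 t : a <= t <= r -> 0 <= W t.
  move=> /andP[at_ tr].
  have := @is_derive_le_le t r W (cst 0) (fun t => - V t) (cst 0) tr.
  rewrite Wr subrr sub0r oppr_le0; apply.
  - by move=> x /andP[tx xr]; apply: dW; rewrite (le_trans at_ tx).
  - by move=> x /andP[tx xr] /=; rewrite oppr_le0 V0// (le_trans at_ tx).
have cp t : {for t, continuous phi} by exact: is_derive_continuous.
rewrite !integral_fold_tent//.
- apply: leeD; first exact: weighted_hardy_left.
  under [leRHS]eq_integral do rewrite -normrN.
  apply: (@weighted_hardy_left a r (fun t => phi (2 * r - t)) (fun t => - dphi (2 * r - t))) => //.
  - move=> t; rewrite -mulrN1.
    exact: (@is_derive1_comp _ phi (fun t => 2 * r - t) t _ _ (dp _) (is_derive_reflection _ _)).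
  - move=> t; apply: continuousN.
    apply: (@continuous_comp _ _ _ (fun t => 2 * r - t) dphi); last exact: cdp.
    exact: is_derive_continuous (is_derive_reflection _ _).
- by move=> t; apply: continuous_norm_fun; exact: cdp.
- by move=> t /dW /is_derive_continuous.
- by move=> t; exact: continuous_norm_fun.
Qed.

End OneDim.

(** * The explicit power and logarithmic weights *)

Section Weights.
Variable R : realType.
Notation mu := (@lebesgue_measure R).

Lemma is_derive_powRN (q t : R) : 0 < t ->
  is_derive t 1 (fun t => (t `^ q)^-1) (- (q * (t `^ (q + 1))^-1)).
Proof.
move=> t0; rewrite (_ : (fun t => (t `^ q)^-1) = (@powR R)^~ (- q)); last first.
  by apply/funext => x; rewrite powRN.
apply: is_derive_eq; first exact: is_derive1_powR.
by rewrite mulNr -powRN opprD.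
Qed.

Lemma is_derive_Xf (t : R) : 0 < t -> t <= 1 -> is_derive t 1 (@Xf R) (Xf t ^+ 2 / t).
Proof.
move=> t0 t1.
have l0 : 0 < 1 - ln t by rewrite subr_gt0 (le_lt_trans (ln_le0 t1)).
have D := @is_deriveB _ _ _ (cst (1 : R)) (@ln R) t 1 0 t^-1 (is_derive_cst _ _ _) (is_derive1_ln t0).
have Dc : cst (1 : R) - @ln R = (fun t => 1 - ln t) by [].
rewrite sub0r Dc in D.
have D2 := @is_deriveV R (fun t : R => 1 - ln t) t _ 1 (lt0r_neq0 l0) D.
apply: (is_derive_eq D2).
by rewrite /Xf exprVn scaleNr scalerN opprK.
Qed.

Lemma Xf_gt0 (t : R) : 0 < t -> t <= 1 -> 0 < Xf t.
Proof. by move=> t0 t1; rewrite /Xf invr_gt0 subr_gt0 (le_lt_trans (ln_le0 t1)). Qed.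

Lemma Xf_le1 (t : R) : t <= 1 -> Xf t <= 1.
Proof.
move=> t1; have l1 : 1 <= 1 - ln t by rewrite lerBrDr gerDl ln_le0.
by rewrite /Xf invf_le1// (lt_le_trans _ l1).
Qed.

Lemma Xf1 : Xf 1 = 1 :> R.
Proof. by rewrite /Xf ln1 subr0 invr1. Qed.

Lemma is_derive_scale (c t : R) : is_derive t 1 (fun t => t * c) c.
Proof.
have := @is_deriveM _ _ id (cst c) t 1 _ _ (is_derive_id _ _) (is_derive_cst _ _ _).
by rewrite scaler0 add0r /GRing.scale/= mulr1.
Qed.

(** As [X'(t) = X(t)^2 / t], differentiating a power of [X] raises its exponent by one and divides
    by [t]; the scale [r] cancels. With [q = gamma - 1] this produces the weight [X^gamma / t]. *)
Lemma is_derive_Xf_powR (r q t : R) : 0 < t <= r ->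
  is_derive t 1 (fun t => Xf (t / r) `^ q) (q * (Xf (t / r) `^ (q + 1) / t)).
Proof.
move=> /andP[t0 tr]; have r0 : 0 < r by exact: lt_le_trans tr.
have tr0 : 0 < t / r by rewrite divr_gt0.
have tr1 : t / r <= 1 by rewrite ler_pdivrMr// mul1r.
have X0 := Xf_gt0 tr0 tr1.
have D1 := @is_derive1_comp _ (@Xf R) (fun t => t / r) t _ _ (is_derive_Xf tr0 tr1) (is_derive_scale _ _).
have D2 := @is_derive1_comp _ ((@powR R)^~ q) _ t _ _ (is_derive1_powR _ X0) D1.
apply: is_derive_eq D2 _.
have -> : Xf (t / r) `^ (q + 1) = Xf (t / r) `^ (q - 1) * Xf (t / r) ^+ 2.
  rewrite -powR_mulrn ?(ltW X0)// -powRD ?lt0r_neq0 ?implybT//.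
  by congr (_ `^ _); ring.
have rN : r != 0 by rewrite lt0r_neq0.
have tN : t != 0 by rewrite lt0r_neq0.
by field; rewrite tN.
Qed.

Section HardyWeights.
Variables (s gamma r : R) (s1 : 1 <= s) (g1 : 1 < gamma) (r0 : 0 < r).

(* [hardyV] is [- hardyW^`()], and is the weight on the right-hand side of the
   inequality with [C = gamma - 1]. *)
Definition hardyW (t : R) :=
  (t `^ (s - 1))^-1 - (r `^ (s - 1))^-1 * Xf (t / r) `^ (gamma - 1).

Definition hardyV (t : R) :=
  (s - 1) * (t `^ s)^-1
  + (r `^ (s - 1))^-1 * ((gamma - 1) * (Xf (t / r) `^ gamma / t)).

Lemma is_derive_hardyW (t : R) : 0 < t <= r -> is_derive t 1 hardyW (- hardyV t).
Proof.
move=> t0r; have /andP[t0 tr] := t0r.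
have D := @is_deriveB _ _ _ _ _ t 1 _ _ (is_derive_powRN (s - 1) t0)
  (@is_deriveZ _ _ _ _ ((r `^ (s - 1))^-1) t 1 _ (is_derive_Xf_powR (gamma - 1) t0r)).
apply: is_derive_eq D _.
by rewrite /hardyV !subrK opprD.
Qed.

Lemma hardyW_r : hardyW r = 0.
Proof. by rewrite /hardyW divff ?lt0r_neq0// Xf1 powR1 mulr1 subrr. Qed.

Lemma hardyV_ge0 (t : R) : 0 < t <= r -> 0 <= hardyV t.
Proof.
move=> /andP[t0 tr]; apply: addr_ge0.
  by rewrite mulr_ge0 ?subr_ge0// invr_ge0 powR_ge0.
rewrite mulr_ge0 ?invr_ge0 ?powR_ge0// mulr_ge0 ?subr_ge0 ?(ltW g1)//.
by rewrite divr_ge0 ?powR_ge0// ltW.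
Qed.

(** Since [X <= 1] and [gamma > 1], the subtracted term is at most [r^(1-s)], which is at most
    [t^(1-s)] for [t <= r]. *)
Lemma hardyW_ge0 (t : R) : 0 < t <= r -> 0 <= hardyW t.
Proof.
move=> /andP[t0 tr]; rewrite subr_ge0.
have tr0 : 0 < t / r by rewrite divr_gt0.
have tr1 : t / r <= 1 by rewrite ler_pdivrMr// mul1r.
apply: (@le_trans _ _ (r `^ (s - 1))^-1).
  rewrite -[leRHS]mulr1 ler_wpM2l ?invr_ge0 ?powR_ge0//.
  rewrite -[leRHS](powRr0 (Xf (t / r))); apply: ger_powR; last by rewrite subr_ge0 ltW.
  by rewrite Xf_gt0// Xf_le1.
rewrite lef_pV2 ?posrE ?powR_gt0//.
by apply: ge0_ler_powR; rewrite ?nnegrE ?subr_ge0// ltW.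
Qed.

Lemma hardyW_le (t : R) : hardyW t <= (t `^ (s - 1))^-1.
Proof. by rewrite /hardyW gerBl mulr_ge0 ?powR_ge0// invr_ge0 powR_ge0. Qed.

Lemma continuous_hardyV (t : R) : 0 < t <= r -> {for t, continuous hardyV}.
Proof.
move=> t0r; have /andP[t0 tr] := t0r.
apply: continuousD.
  apply: continuousM; first exact: cvg_cst.
  exact: is_derive_continuous (is_derive_powRN s t0).
apply: continuousM; first exact: cvg_cst.
apply: continuousM; first exact: cvg_cst.
apply: continuousM; first exact: is_derive_continuous (is_derive_Xf_powR gamma t0r).
by apply: continuousV; [exact: lt0r_neq0|exact: cvg_id].
Qed.

(** The margin [a] keeps the support away from 0 and [2r], where the weights are singular. On
    [[a, 2r - a]] the weighted inequality applies; then [hardyW] is bounded by [t^(1-s)] and the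
    right-hand integral is enlarged to the whole of [(0, 2r)]. *)
Lemma hardy_strip_1d (a : R) (phi dphi : R -> R) : 0 < a < r ->
  (forall t : R, is_derive t 1 phi (dphi t)) -> continuous dphi ->
  (forall t, ~~ (a < t < 2 * r - a) -> phi t = 0) ->
  (\int[mu]_t (`|phi t| * hardyV (tent r t))%:E <=
   \int[mu]_t (if 0 < t < 2 * r then `|dphi t| / tent r t `^ (s - 1) else 0)%:E)%E.
Proof.
move=> /andP[a0 ar] dp cdp p0.
have pos t : a <= t <= r -> 0 < t <= r by move=> /andP[at_ ->]; rewrite (lt_le_trans a0 at_).
apply: (@le_trans _ _ (\int[mu]_(t in `[a, (2 * r - a)%R]) (`|phi t| * hardyV (tent r t))%:E)%E).
  rewrite [leRHS]integral_mkcond le_eqVlt; apply/orP; left; apply/eqP.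
  apply: eq_integral => t _; rewrite patchE; case: ifPn => //.
  rewrite notin_setE/= in_itv/= => /negP h; rewrite p0 ?normr0 ?mul0r//.
  by apply: contra h => /andP[/ltW -> /ltW ->].
apply: (@le_trans _ _ (\int[mu]_(t in `[a, (2 * r - a)%R]) (`|dphi t| * hardyW (tent r t))%:E)%E).
  apply: weighted_hardy => //.
  - by apply: p0; rewrite ltxx.
  - by apply: p0; rewrite ltxx andbF.
  - by move=> t /pos; exact: is_derive_hardyW.
  - exact: hardyW_r.
  - by move=> t /pos; exact: continuous_hardyV.
  - by move=> t /pos; exact: hardyV_ge0.
rewrite integral_mkcond; apply: le_integralT => t; rewrite patchE; case: ifPn => //.
- rewrite inE/= in_itv/= => tab; rewrite lee_fin mulr_ge0// hardyW_ge0//.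
  exact/pos/tent_bounds.
- by rewrite inE/= in_itv/= => tab; rewrite ifT; [rewrite lee_fin ler_wpM2l// hardyW_le|lra].
- by move=> _; rewrite lee_fin; case: ifP => // _; rewrite mulr_ge0// invr_ge0 powR_ge0.
Qed.

End HardyWeights.
End Weights.

(** * The inequality on the strip *)

Section Strip.
Variable R : realType.
Notation mu := (@lebesgue_measure R).

Lemma coord_le_enorm n (v : 'rV[R]_n) (i : 'I_n) : `|v 0 i| <= enorm v.
Proof.
rewrite /enorm -sqrtr_sqr ler_wsqrtr// (bigD1 i)//= lerDl.
by apply: sumr_ge0 => j _; exact: sqr_ge0.
Qed.

Lemma enorm_setc n (x : 'rV[R]_n) (i : 'I_n) (t : R) : enorm (x - setc i x t) = `|x 0 i - t|.
Proof.
rewrite /enorm (bigD1 i)//= big1 ?addr0; last first.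
  by move=> j ji; rewrite !mxE (negbTE ji) subrr expr0n.
by rewrite !mxE eqxx sqrtr_sqr.
Qed.

(** Moving only the last coordinate to 0 or to [2r] reaches the complement at cost [x_n] or
    [2r - x_n]. Conversely, a point outside the strip differs from [x] in the last coordinate alone
    by at least the smaller of these. *)
Lemma dS_tent n (r : R) (x : 'rV[R]_n.+1) : strip n.+1 r x -> dS r x = tent r (x 0 ord_max).
Proof.
rewrite /strip /= => /andP[x0 xr].
set A := [set enorm (x - y) | y in ~` @strip R n.+1 r].
have m0 : A (x 0 ord_max).
  exists (setc ord_max x 0); last by rewrite enorm_setc subr0 ger0_norm// ltW.
  by rewrite /strip/= mxE eqxx ltxx.
have m1 : A (2 * r - x 0 ord_max).
  exists (setc ord_max x (2 * r)); last by rewrite enorm_setc ltr0_norm ?opprB// subr_lt0.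
  by rewrite /strip/= mxE eqxx ltxx andbF.
have lb : lbound A (tent r (x 0 ord_max)).
  move=> _ [y /= ys <-]; rewrite /tent ge_min.
  have := coord_le_enorm (x - y) ord_max; rewrite !mxE => h.
  have {}ys : ~ (0 < y 0 ord_max < 2 * r) := ys.
  move/negP : ys; rewrite negb_and -!leNgt => /orP[y0|yr]; apply/orP; [left|right].
    by apply: le_trans h; rewrite (le_trans _ (ler_norm _))//; lra.
  by apply: le_trans h; rewrite distrC (le_trans _ (ler_norm _))//; lra.
apply/eqP; rewrite eq_le; apply/andP; split.
  rewrite /tent le_min; apply/andP; split; apply: ge_inf => //;
    by exists (tent r (x 0 ord_max)).
by apply: lb_le_inf => //; exists (x 0 ord_max).
Qed.

Lemma setc_shift n (i : 'I_n) (x : 'rV[R]_n) (h t : R) :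
  h *: evec R i + setc i x t = setc i x (h + t) :> 'rV[R]_n.
Proof.
apply/rowP => j; rewrite !mxE eq_sym; case: eqP => _; first by rewrite mulr1.
by rewrite mulr0 add0r.
Qed.

Lemma is_derive_setc n (i : 'I_n) (u : 'rV[R]_n -> R) (x : 'rV[R]_n) (t : R) :
  derivable u (setc i x t) (evec R i) ->
  is_derive t 1 (fun t => u (setc i x t)) (partial i u (setc i x t)).
Proof.
have E : (fun h : R => h^-1 *: (((fun t => u (setc i x t)) \o shift t) (h *: (1 : R)) - u (setc i x t)))
  = (fun h : R => h^-1 *: ((u \o shift (setc i x t)) (h *: evec R i) - u (setc i x t))).
  apply/funext => h; congr (_ *: (_ - _)).
  by rewrite /shift/= setc_shift /GRing.scale/= mulr1.
move=> du; apply: DeriveDef; rewrite /derivable /derive; first by rewrite E.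
by rewrite /partial /derive E.
Qed.

Lemma partial_le_grad_norm n (u : 'rV[R]_n -> R) (i : 'I_n) (x : 'rV[R]_n) :
  `|partial i u x| <= grad_norm u x.
Proof.
have := coord_le_enorm (\row_i partial i u x) i.
by rewrite /enorm mxE; under eq_bigr do rewrite mxE.
Qed.

Lemma continuous_setc n (i : 'I_n) (x : 'rV[R]_n) : continuous (setc i x).
Proof.
have -> : setc i x = fun t => t *: evec R i + setc i x 0.
  by apply/funext => t; rewrite setc_shift addr0.
move=> t; apply: cvgD; last exact: cvg_cst.
by apply: cvgZl; exact: cvg_id.
Qed.

(** The continuous function [tent r x_n] attains a positive minimum on the compact support. This
    gives one margin [a] valid for all slices of [u]. *)
Lemma compact_support_margin n (r : R) (u : 'rV[R]_n.+1 -> R) : 0 < r ->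
  Cc_inf (strip n.+1 r) u ->
  exists2 a, 0 < a < r & forall x, u x != 0 -> a < x 0 ord_max < 2 * r - a.
Proof.
move=> r0 [_ [cK Ks]]; set K := closure _ in cK Ks.
have [K0|/set0P Kn0] := eqVneq K set0.
  exists (r / 2); first by lra.
  by move=> x ux; have : K x by [apply: subset_closure]; rewrite K0.
pose f (x : 'rV[R]_n.+1) := tent r (x 0 ord_max).
have cf : continuous f.
  move=> x; apply: (@continuous_comp _ _ _ (fun x : 'rV[R]_n.+1 => x 0 ord_max) (tent r)).
    exact: coord_continuous.
  exact: continuous_tent.
have [c cK' cmin] := compact_EVT_min Kn0 cK (continuous_subspaceT cf).
have fc0 : 0 < f c.
  by have /Ks /andP[c0 cr] := set_mem cK'; rewrite /f /tent lt_min c0 subr_gt0.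
(* Half of the minimum makes the bounds strict; the cap [r / 2] ensures [a < r]. *)
exists (Num.min (f c / 2) (r / 2)).
  by rewrite lt_min gt_min; apply/andP; split; lra.
move=> x ux.
have fcx : f c <= f x by apply: cmin; rewrite inE; exact: subset_closure.
set m := Num.min _ _.
have mc : m <= f c / 2 by rewrite /m ge_min lexx.
have : m < f x by lra.
by rewrite /f /tent lt_min => /andP[mx mrx]; apply/andP; split; lra.
Qed.

(** On each line parallel to the last axis the slice of [u] obeys the one-dimensional inequality,
    and its derivative is bounded by [grad_norm u]. *)
Lemma hardy_strip_part1 n (r s gamma : R) (u : 'rV[R]_n.+1 -> R) :
  0 < r -> 1 <= s -> 1 < gamma -> Cc_inf (strip n.+1 r) u ->
  (lebn_on (strip n.+1 r) (fun x => (grad_norm u x / dS r x `^ (s - 1))%:E)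
   >= (s - 1)%:E * lebn_on (strip n.+1 r) (fun x => (`|u x| / dS r x `^ s)%:E)
      + ((gamma - 1) / r `^ (s - 1))%:E *
        lebn_on (strip n.+1 r)
          (fun x => (`|u x| / dS r x * Xf (dS r x / r) `^ gamma)%:E))%E.
Proof.
move=> r0 s1 g1 uC; have [a a0r ua] := compact_support_margin r0 uC.
have [smu _] := uC.
have dSge0 (x : 'rV[R]_n.+1) : strip n.+1 r x -> 0 <= dS r x.
  move=> xs; rewrite dS_tent//; move: xs => /andP[x0 xr].
  by rewrite /tent le_min ltW//= subr_ge0 ltW.
apply: lebn_comb_le => //.
- by rewrite subr_ge0.
- by rewrite divr_ge0 ?powR_ge0// subr_ge0 ltW.
- by move=> x; case: ifP => // _; rewrite lee_fin divr_ge0 ?powR_ge0.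
- move=> x; case: ifPn => //; rewrite inE => xs.
  by rewrite lee_fin mulr_ge0 ?powR_ge0// divr_ge0// dSge0.
- by move=> x; case: ifP => // _; rewrite lee_fin divr_ge0 ?powR_ge0// sqrtr_ge0.
move=> x.
pose phi t := u (setc ord_max x t).
pose dphi t := partial ord_max u (setc ord_max x t).
have dp (t : R) : is_derive t 1 phi (dphi t).
  by apply: is_derive_setc; apply: diff_derivable; exact: (smu [::]).
have cdp : continuous dphi.
  move=> t; apply: (@continuous_comp _ _ _ (setc ord_max x) (partial ord_max u)).
    exact: continuous_setc.
  by apply: differentiable_continuous; exact: (smu [:: evec R ord_max]).
have p0 t : ~~ (a < t < 2 * r - a) -> phi t = 0.
  apply: contraNeq => /ua; rewrite mxE eqxx => //.
have H := hardy_strip_1d s1 g1 r0 a0r dp cdp p0.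
have inS t : (setc ord_max x t \in strip n.+1 r) = (0 < t < 2 * r).
  by apply/idP/idP; rewrite inE /strip/= mxE eqxx.
have dSt t : 0 < t < 2 * r -> dS r (setc ord_max x t) = tent r t.
  by move=> tr; rewrite dS_tent ?mxE ?eqxx//; rewrite -in_setE inS.
(* The two weights of the lower bound are the two summands of [hardyV], so both integrals merge into
   one by superadditivity. *)
apply: (@le_trans _ _ (\int[mu]_t (`|phi t| * hardyV s gamma r (tent r t))%:E)%E).
  apply: integral_comb_le.
  - by rewrite subr_ge0.
  - by rewrite divr_ge0 ?powR_ge0// subr_ge0 ltW.
  - by move=> t; case: ifP => // _; rewrite lee_fin divr_ge0 ?powR_ge0.
  - move=> t; case: ifPn => //; rewrite inE => xs.
    by rewrite lee_fin mulr_ge0 ?powR_ge0// divr_ge0// dSge0.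
  move=> t; rewrite inS; case: ifPn => tr; last first.
    rewrite p0 ?normr0 ?mul0r ?mule0 ?adde0//.
    by apply: contra tr => /andP[t1 t2]; apply/andP; split; lra.
  rewrite dSt// -!EFinM -EFinD lee_fin -/(phi t) /hardyV le_eqVlt; apply/orP; left; apply/eqP.
  have tp : tent r t != 0 by rewrite gt_eqF// /tent lt_min; lra.
  by ring.
apply: (le_trans H); apply: le_integralT => t.
  by rewrite lee_fin; case: ifP => // _; rewrite mulr_ge0// invr_ge0 powR_ge0.
rewrite inS; case: ifPn => // tr.
by rewrite dSt// lee_fin ler_wpM2r ?invr_ge0 ?powR_ge0// partial_le_grad_norm.
Qed.

End Strip.

(** * Smooth cutoffs *)

Section Smooth.
Variable R : realType.

(** The functions [p(1/t) exp(-1/t)], extended by 0. The polynomial factor makes the family stable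
    under differentiation. *)
Definition flat (p : {poly R}) (t : R) : R :=
  if 0 < t then p.[t^-1] * expR (- t^-1) else 0.

Lemma flat_le0 p t : t <= 0 -> flat p t = 0.
Proof. by rewrite /flat leNgt => /negbTE ->. Qed.

Lemma flat_gt0 p t : 0 < t -> flat p t = p.[t^-1] * expR (- t^-1).
Proof. by rewrite /flat => ->. Qed.

(** With [y = 1/t], the bound [exp y >= y^(n+1) / (n+1)!] gives [y^n exp(-y) <= (n+1)! t]. *)
Lemma flat_Xn_bound n (t : R) : `|flat 'X^n t| <= n.+1`!%:R * `|t|.
Proof.
have [t0|t0] := leP t 0; first by rewrite flat_le0// normr0 mulr_ge0.
rewrite flat_gt0// hornerXn !gtr0_norm ?mulr_gt0 ?exprn_gt0 ?invr_gt0 ?expR_gt0//.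
have y0 : 0 < t^-1 by rewrite invr_gt0.
have := expR_ge1Dxn n (ltW y0); rewrite expRN => h.
have {}h : t^-1 ^+ n.+1 / n.+1`!%:R <= expR t^-1 by lra.
rewrite ler_pdivrMr ?expR_gt0//.
have F0 : 0 < n.+1`!%:R :> R by rewrite ltr0n fact_gt0.
have -> : t^-1 ^+ n = (n.+1`!%:R * t) * (t^-1 ^+ n.+1 / n.+1`!%:R).
  rewrite exprS; field.
  by rewrite lt0r_neq0//= lt0r_neq0.
by apply: ler_wpM2l => //; rewrite mulr_ge0 ?ltW.
Qed.

Lemma flat_bound (p : {poly R}) : exists2 C, 0 <= C & forall t, `|flat p t| <= C * `|t|.
Proof.
exists (\sum_(i < size p) `|p`_i| * i.+1`!%:R); first by apply: sumr_ge0 => i _; rewrite mulr_ge0.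
move=> t; have -> : flat p t = \sum_(i < size p) p`_i * flat 'X^i t.
  rewrite /flat; case: ifP => _; last by rewrite big1// => i _; rewrite mulr0.
  by rewrite horner_coef mulr_suml; apply: eq_bigr => i _; rewrite hornerXn mulrA.
rewrite (le_trans (ler_norm_sum _ _ _))// mulr_suml; apply: ler_sum => i _.
by rewrite normrM -mulrA ler_wpM2l// flat_Xn_bound.
Qed.

(** The polynomial of the derivative: differentiating [p(y) exp(-y)] in [t] with [y = 1/t] gives
    [y^2 (p(y) - p'(y)) exp(-y)]. *)
Definition dflat (p : {poly R}) : {poly R} := 'X^2 * (p - p^`()).

Lemma is_derive_horner (p : {poly R}) (t : R) : is_derive t 1 (horner p) p^`().[t].
Proof.
by apply: DeriveDef; [exact: derivable_horner|rewrite -derive1E -derivE].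
Qed.

Lemma is_derive_flat p (t : R) : is_derive t 1 (flat p) (flat (dflat p) t).
Proof.
have [t0|t0|->] := ltgtP t 0.
- rewrite [flat (dflat p) t]flat_le0 ?ltW//; apply: (@near_eq_is_derive _ _ _ (cst 0)).
    near=> x; rewrite flat_le0// ltW//; near: x; exact: lt_nbhsl.
- have nE : \forall x \near t, p.[x^-1] * expR (- x^-1) = flat p x.
    near=> x; rewrite flat_gt0//; near: x; exact: lt_nbhsr.
  apply: (near_eq_is_derive nE).
  have tN : t != 0 by rewrite lt0r_neq0.
  have D1 := @is_deriveV R id t _ 1 tN (is_derive_id _ _).
  have D2 := @is_derive1_comp _ (horner p) (fun t => t^-1) t p^`().[t^-1] _ (is_derive_horner p _) D1.
  have D3 := @is_derive1_comp _ (@expR R) (fun t => - t^-1) t _ _ (is_derive_expR _) (is_deriveN D1).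
  apply: (is_derive_eq (is_deriveM D2 D3)).
  rewrite flat_gt0// /dflat hornerM hornerXn hornerD hornerN /= /GRing.scale/= -exprVn.
  by ring.
- rewrite [flat (dflat p) 0]flat_le0//.
  (* At 0 the difference quotient [flat p h / h] again belongs to the family, with polynomial
     ['X * p]; the linear bound sends it to 0. *)
  have E : (fun h : R => h^-1 *: ((flat p \o shift 0) (h *: (1 : R)) - flat p 0)) = flat ('X * p).
    apply/funext => h; rewrite /= addr0 [flat p 0]flat_le0// subr0 /GRing.scale/= mulr1.
    by rewrite /flat; case: ifP => _; rewrite ?mulr0// hornerM hornerX mulrA.
  have [C C0 HC] := flat_bound ('X * p).
  have L : flat ('X * p) h @[h --> 0^'] --> (0 : R).
    apply: norm_cvg0; apply: (@squeeze_cvgr _ _ _ _ (cst 0) (fun h : R => C * `|h|)).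
    + by apply: nearW => h /=; rewrite normr_ge0 HC.
    + exact: cvg_cst.
    + rewrite -[X in _ --> X](mulr0 C); apply: cvgM; first exact: cvg_cst.
      rewrite -[X in _ --> X](normr0 R); apply: cvg_norm; exact: nbhs_dnbhs.
  apply: DeriveDef; rewrite /derivable /derive E; first by apply/cvg_ex; exists 0.
  exact: cvg_lim.
Unshelve. all: by end_near. Qed.

(* A class of differentiable functions closed under directional derivatives. *)
Inductive flat_alg n : ('rV[R]_n -> R) -> Prop :=
| flat_alg_base p c e (i : 'I_n) : flat_alg (fun x => flat p (c * x 0 i + e))
| flat_alg_cst c : flat_alg (cst c)
| flat_algD f g : flat_alg f -> flat_alg g -> flat_alg (f + g)
| flat_algM f g : flat_alg f -> flat_alg g -> flat_alg (f * g).

(** If [f] restricted to the line through [x] in direction [v] is [g] shifted by [t], the two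
    difference quotients coincide. *)
Lemma derive_along n (f : 'rV[R]_n -> R) (x v : 'rV[R]_n) (g : R -> R) (t dg : R) :
  (forall h, f (h *: v + x) = g (h + t)) ->
  is_derive t 1 g dg -> is_derive x v f dg.
Proof.
move=> fg [dgt <-].
have E : (fun h : R => h^-1 *: ((f \o shift x) (h *: v) - f x)) =
         (fun h : R => h^-1 *: ((g \o shift t) (h *: (1 : R)) - g t)).
  apply/funext => h; congr (_ *: (_ - _)).
    by rewrite /= fg /GRing.scale/= mulr1.
  by have := fg 0; rewrite scale0r !add0r.
by apply: DeriveDef; [move: dgt|]; rewrite /derivable /derive E.
Qed.

Lemma is_derive_flat_coord n (p : {poly R}) (c e : R) (i : 'I_n) (x v : 'rV[R]_n) :
  is_derive x v (fun x => flat p (c * x 0 i + e))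
    (c * v 0 i * flat (dflat p) (c * x 0 i + e)).
Proof.
apply: (@derive_along _ _ _ _ (fun h => flat p (h * (c * v 0 i) + (c * x 0 i + e))) 0).
  by move=> h; rewrite !mxE addr0; congr flat; ring.
have D : is_derive (0 : R) 1 (fun h => h * (c * v 0 i) + (c * x 0 i + e)) (c * v 0 i).
  have := @is_deriveD _ _ _ _ _ (0 : R) 1 _ _ (is_derive_scale (c * v 0 i) 0)
    (is_derive_cst (c * x 0 i + e) (0 : R) (1 : R)).
  by rewrite addr0.
have := @is_derive1_comp _ (flat p) _ 0 _ _ (is_derive_flat p _) D.
by rewrite mul0r add0r [X in is_derive _ _ _ X -> _]mulrC.
Qed.

Lemma flat_alg_differentiable n (f : 'rV[R]_n -> R) : flat_alg f ->
  forall x, differentiable f x.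
Proof.
elim=> [p c e i|c|{}f g _ IHf _ IHg|{}f g _ IHf _ IHg] x.
- apply: (@differentiable_comp _ _ _ _ (fun x : 'rV[R]_n => c * x 0 i + e) (flat p)).
    apply: differentiableD => //; apply: differentiableM => //.
    exact: differentiable_coord.
  by apply/derivable1_diffP; have [] := is_derive_flat p (c * x 0 i + e).
- exact: differentiable_cst.
- exact: differentiableD.
- exact: differentiableM.
Qed.

(** The derivative of a generator is a constant times the generator with polynomial [dflat p]; sums
    and products follow from the usual rules. *)
Lemma flat_alg_derive n (f : 'rV[R]_n -> R) : flat_alg f ->
  forall v, flat_alg (fun x => 'D_v f x).
Proof.
move=> ff v; elim: ff => [p c e i|c|{}f g ff IHf fg IHg|{}f g ff IHf fg IHg].
- rewrite (_ : (fun x => _) =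
    cst (c * v 0 i) * (fun x : 'rV[R]_n => flat (dflat p) (c * x 0 i + e))).
    by apply: flat_algM; [exact: flat_alg_cst|exact: flat_alg_base].
  by apply/funext => x; have [_ ->] := is_derive_flat_coord p c e i x v.
- rewrite (_ : (fun x => _) = cst 0); first exact: flat_alg_cst.
  by apply/funext => x; rewrite derive_cst.
- rewrite (_ : (fun x => _) = (fun x => 'D_v f x) + (fun x => 'D_v g x)); first exact: flat_algD.
  by apply/funext => x; rewrite deriveD//; apply: diff_derivable; exact: flat_alg_differentiable.
- rewrite (_ : (fun x => _) = f * (fun x => 'D_v g x) + g * (fun x => 'D_v f x)).
    by apply: flat_algD; exact: flat_algM.
  by apply/funext => x; rewrite deriveM//; apply: diff_derivable; exact: flat_alg_differentiable.
Qed.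

Lemma flat_alg_smooth n (f : 'rV[R]_n -> R) : flat_alg f -> smooth f.
Proof.
move=> ff vs x; apply: flat_alg_differentiable.
by elim: vs => //= v vs IH; exact: flat_alg_derive.
Qed.

Lemma flat_dflat1 (t : R) : flat (dflat 1) t = t^-1 ^+ 2 * flat 1 t.
Proof.
rewrite /flat /dflat; case: ifP => _; last by rewrite mulr0.
by rewrite derivC subr0 mulr1 hornerXn hornerC mul1r.
Qed.

(** * The symmetric cutoff and its derivative *)

(* Up to rescaling, [exp(-1/(t-del)) * exp(-1/(2 rho-t-del))] on
   [del < t < 2 rho - del]; it increases up to the midpoint [rho]. *)
Definition cutoff (rho del t : R) : R :=
  flat 1 (del^-1 * t + -1) * flat 1 (- del^-1 * t + (2 * rho / del - 1)).

Definition dcutoff (rho del t : R) : R :=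
  del^-1 * (flat (dflat 1) (del^-1 * t + -1) * flat 1 (- del^-1 * t + (2 * rho / del - 1))
    - flat 1 (del^-1 * t + -1) * flat (dflat 1) (- del^-1 * t + (2 * rho / del - 1))).

Lemma is_derive_affine (c e t : R) : is_derive t 1 (fun t => c * t + e) c.
Proof.
have := @is_deriveD _ _ _ _ _ t 1 _ _ (is_derive_scale c t) (is_derive_cst e t (1 : R)).
by rewrite addr0; under eq_fun do rewrite mulrC.
Qed.

Lemma is_derive_cutoff (rho del t : R) : is_derive t 1 (cutoff rho del) (dcutoff rho del t).
Proof.
have D c e := @is_derive1_comp _ (flat 1) (fun t => c * t + e) t _ _
  (is_derive_flat 1 (c * t + e)) (is_derive_affine c e t).
apply: (is_derive_eq (is_deriveM (D del^-1 (-1)) (D (- del^-1) (2 * rho / del - 1)))).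
by rewrite /dcutoff /GRing.scale/=; ring.
Qed.

Lemma continuous_flat p : continuous (flat p).
Proof. by move=> t; exact: is_derive_continuous (is_derive_flat p t). Qed.

Lemma continuous_dcutoff (rho del : R) : continuous (dcutoff rho del).
Proof.
move=> t.
have C p (c e : R) : {for t, continuous (fun t : R => flat p (c * t + e))}.
  apply: (@continuous_comp _ _ _ (fun t : R => c * t + e) (flat p)); last exact: continuous_flat.
  exact: is_derive_continuous (is_derive_affine c e t).
have cdel : {for t, continuous (cst del^-1 : R -> R)} by exact: cvg_cst.
pose f1 (t : R) := flat 1 (del^-1 * t + -1).
pose f2 (t : R) := flat 1 (- del^-1 * t + (2 * rho / del - 1)).
pose g1 (t : R) := flat (dflat 1) (del^-1 * t + -1).
pose g2 (t : R) := flat (dflat 1) (- del^-1 * t + (2 * rho / del - 1)).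
rewrite (_ : dcutoff rho del = cst del^-1 * (g1 * f2 - f1 * g2))//.
apply: continuousM => //.
by apply: continuousB; apply: continuousM; exact: C.
Qed.

Lemma flat_ge0 (t : R) : 0 <= flat 1 t.
Proof. by rewrite /flat; case: ifP => // _; rewrite hornerC mul1r expR_ge0. Qed.

Lemma flat_le1 (t : R) : flat 1 t <= 1.
Proof.
rewrite /flat; case: ifP => // t0; rewrite hornerC mul1r -expR0 ler_expR oppr_le0 invr_ge0 ltW//.
Qed.

Lemma cutoff_ge0 (rho del t : R) : 0 <= cutoff rho del t.
Proof. by rewrite mulr_ge0 ?flat_ge0. Qed.

Lemma cutoff_le1 (rho del t : R) : cutoff rho del t <= 1.
Proof. by rewrite mulr_ile1 ?flat_ge0 ?flat_le1. Qed.

Section Cutoff.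
Variables (rho del : R) (del0 : 0 < del).

Let left_arg (t : R) : del^-1 * t + -1 = (t - del) / del.
Proof. by field; rewrite lt0r_neq0. Qed.

Let right_arg (t : R) : - del^-1 * t + (2 * rho / del - 1) = (2 * rho - t - del) / del.
Proof. by field; rewrite lt0r_neq0. Qed.

Lemma cutoff_out (t : R) : ~~ (del < t < 2 * rho - del) -> cutoff rho del t = 0.
Proof.
rewrite /cutoff left_arg right_arg negb_and -!leNgt => /orP[h|h].
  by rewrite flat_le0 ?mul0r// pmulr_lle0 ?invr_gt0// subr_le0.
by rewrite [X in _ * X]flat_le0 ?mulr0// pmulr_lle0 ?invr_gt0//; lra.
Qed.

Lemma dcutoff_out (t : R) : ~~ (del < t < 2 * rho - del) -> dcutoff rho del t = 0.
Proof.
rewrite /dcutoff left_arg right_arg negb_and -!leNgt => /orP[h|h].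
  by rewrite !(@flat_le0 _ ((t - del) / del)) ?mul0r ?subrr ?mulr0// pmulr_lle0 ?invr_gt0// subr_le0.
rewrite !(@flat_le0 _ ((2 * rho - t - del) / del)) ?mulr0 ?subrr ?mulr0// pmulr_lle0 ?invr_gt0//; lra.
Qed.

Lemma cutoff_sym (t : R) : cutoff rho del (2 * rho - t) = cutoff rho del t.
Proof.
by rewrite /cutoff !left_arg !right_arg mulrC; congr (flat _ (_ / _) * flat _ (_ / _)); ring.
Qed.

Lemma dcutoff_sym (t : R) : dcutoff rho del (2 * rho - t) = - dcutoff rho del t.
Proof.
rewrite /dcutoff !left_arg !right_arg.
have -> : 2 * rho - (2 * rho - t) - del = t - del by ring.
by ring.
Qed.

Lemma flat1_ge (t : R) : 1 <= t -> expR (-1) <= flat 1 t.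
Proof.
move=> t1; have t0 : 0 < t by exact: lt_le_trans t1.
by rewrite flat_gt0// hornerC mul1r ler_expR lerN2 invf_le1.
Qed.

(** At distance at least [del] from both ends of the support, both rescaled arguments are at least
    1, and each factor is at least [exp(-1)]. *)
Lemma cutoff_ge (t : R) : 2 * del <= t <= 2 * rho - 2 * del ->
  expR (-1) ^+ 2 <= cutoff rho del t.
Proof.
move=> /andP[t1 t2]; rewrite expr2 /cutoff left_arg right_arg.
by apply: ler_pM; rewrite ?expR_ge0//; apply: flat1_ge; rewrite ler_pdivlMr// mul1r; lra.
Qed.

(** With [a] and [b] the rescaled distances to the two ends of the support, the derivative is a
    positive multiple of [(a^(-2) - b^(-2))] times the cutoff, and [t <= rho] means [a <= b]. *)
Lemma dcutoff_ge0 (t : R) : t <= rho -> 0 <= dcutoff rho del t.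
Proof.
move=> tr; rewrite /dcutoff left_arg right_arg mulr_ge0 ?invr_ge0 ?(ltW del0)//.
set a := (t - del) / del; set b := (_ - del) / del.
have ab : a <= b by rewrite ler_pM2r ?invr_gt0//; lra.
have [a0|a0] := leP a 0; first by rewrite !(@flat_le0 _ a)// !mul0r subrr.
have b0 : 0 < b by exact: lt_le_trans ab.
rewrite !flat_dflat1.
rewrite (_ : _ - _ = (a^-1 ^+ 2 - b^-1 ^+ 2) * (flat 1 a * flat 1 b)); last by ring.
rewrite mulr_ge0 ?mulr_ge0 ?flat_ge0// subr_ge0.
by rewrite lerXn2r ?nnegrE ?invr_ge0 ?(ltW a0) ?(ltW b0)// lef_pV2.
Qed.

End Cutoff.
End Smooth.

(** * Optimality *)

Section ProductIntegral.
Variable R : realType.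
Notation mu := (@lebesgue_measure R).

Lemma integral_lincomb K (c I : 'I_K -> R) (h : 'I_K -> R -> R) :
  (forall k, 0 <= c k) -> (forall k t, 0 <= h k t) ->
  (forall k, measurable_fun setT (h k)) ->
  (forall k, (\int[mu]_t (h k t)%:E = (I k)%:E)%E) ->
  (\int[mu]_t (\sum_(k < K) c k * h k t)%:E = (\sum_(k < K) c k * I k)%:E)%E.
Proof.
move=> c0 h0 mh hI.
under eq_integral do rewrite -sumEFin.
rewrite ge0_integral_sum//=.
- rewrite -sumEFin; apply: eq_bigr => k _.
  under eq_integral do rewrite EFinM.
  rewrite ge0_integralZl_EFin//; first by rewrite hI EFinM.
  + by move=> t _; rewrite lee_fin.
  + apply/measurable_EFinP; exact: mh.
- by move=> k; apply/measurable_EFinP; apply: measurable_funM; [exact: measurable_cst|exact: mh].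
- by move=> k t _; rewrite lee_fin mulr_ge0.
Qed.

(** Induction on the dimension: the factor in the outermost variable is absorbed into the
    coefficients [c] while the inner integral is evaluated. Carrying a sum over [k] allows the
    gradient bound, a sum of products, to be integrated exactly. *)
Lemma lebn_sum_prod n K (c : 'I_K -> R) (h : 'I_K -> 'I_n -> R -> R) (I : 'I_K -> 'I_n -> R) :
  (forall k, 0 <= c k) -> (forall k i t, 0 <= h k i t) ->
  (forall k i, measurable_fun setT (h k i)) ->
  (forall k i, (\int[mu]_t (h k i t)%:E = (I k i)%:E)%E) ->
  lebn (fun x : 'rV[R]_n => (\sum_(k < K) c k * \prod_(i < n) h k i (x 0 i))%:E)
  = (\sum_(k < K) c k * \prod_(i < n) I k i)%:E.
Proof.
elim: n c h I => [|n IH] c h I c0 h0 mh hI.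
  by rewrite /=; apply: congr1; apply: eq_bigr => k _; rewrite !big_ord0.
have I0 k i : 0 <= I k i.
  by rewrite -lee_fin -hI; apply: integral_ge0 => t _; rewrite lee_fin.
rewrite lebnS.
transitivity (\int[mu]_t (\sum_(k < K) (c k * \prod_(i < n) I k (lift ord0 i)) * h k ord0 t)%:E)%E.
  apply: eq_integral => t _.
  transitivity (lebn (fun y : 'rV[R]_n =>
     (\sum_(k < K) (c k * h k ord0 t) * \prod_(i < n) h k (lift ord0 i) (y 0 i))%:E)).
    congr lebn; apply/funext => y; congr EFin; apply: eq_bigr => k _.
    rewrite big_ord_recl mulrA; congr (_ * _ * _).
      rewrite mxE; case: splitP => j /= jk; first by rewrite mxE.
      by have := ltn_ord j; rewrite -ltnS.
    apply: eq_bigr => i _; congr (h k _ _); rewrite mxE; case: splitP => j /= jk.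
      by move: (ltn_ord j); rewrite -jk.
    by congr (y _ _); apply/val_inj => /=; move: jk; rewrite /bump leq0n add1n => -[].
  rewrite (IH (fun k => c k * h k ord0 t) (fun k i => h k (lift ord0 i))
    (fun k i => I k (lift ord0 i)))//.
    by congr EFin; apply: eq_bigr => k _; rewrite mulrAC.
  by move=> k; rewrite mulr_ge0.
rewrite (integral_lincomb (I := fun k => I k ord0))//.
  by congr EFin; apply: eq_bigr => k _; rewrite big_ord_recl -mulrA; congr (_ * _); rewrite mulrC.
by move=> k; rewrite mulr_ge0// prodr_ge0.
Qed.

End ProductIntegral.

(** * One-dimensional integrals of the cutoff against weights *)

Section CutoffIntegral.
Variable R : realType.
Notation mu := (@lebesgue_measure R).

Section Tent.
Variables (a rho : R) (f V : R -> R).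
Hypotheses (arho : a < rho) (f0 : forall t, 0 <= f t) (cf : forall t, {for t, continuous f}).
Hypotheses (fout : forall t, ~~ (a < t < 2 * rho - a) -> f t = 0).
Hypotheses (fsym : forall t, f (2 * rho - t) = f t).
Hypotheses (V0 : forall t, a <= t <= rho -> 0 <= V t).
Hypotheses (cV : forall t, a <= t <= rho -> {for t, continuous V}).

Let restrict_tent : (fun t => f t * V (tent rho t)) =
  (fun t => f t * V (tent rho t)) \_ `[a, (2 * rho - a)].
Proof.
apply/funext => t; rewrite patchE; case: ifPn => //.
rewrite notin_setE/= in_itv/= => /negP h; rewrite fout ?mul0r//.
by apply: contra h => /andP[/ltW -> /ltW ->].
Qed.

Lemma tent_measurable : measurable_fun setT (fun t => f t * V (tent rho t)).
Proof.
rewrite restrict_tent; apply/(measurable_restrictT _ _).1 => //.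
apply: measurable_fun_segment => t tab; apply: continuousM; first exact: cf.
by apply: continuous_comp; [exact: continuous_tent|apply: cV; exact: tent_bounds].
Qed.

Lemma tent_ge0 t : 0 <= f t * V (tent rho t).
Proof.
have [tab|tab] := boolP (a < t < 2 * rho - a); last by rewrite fout ?mul0r.
by rewrite mulr_ge0// V0// tent_bounds//; case/andP: tab => /ltW -> /ltW ->.
Qed.

Lemma tent_integral : (\int[mu]_t (f t * V (tent rho t))%:E =
  2%:E * \int[mu]_(t in `[a, rho]) (f t * V t)%:E)%E.
Proof.
transitivity (\int[mu]_(t in `[a, (2 * rho - a)%R]) (f t * V (tent rho t))%:E)%E.
  rewrite [RHS]integral_mkcond; apply: eq_integral => t _.
  rewrite [in LHS](congr1 (fun g => g t) restrict_tent) !patchE.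
  by case: ifP.
rewrite integral_fold_tent//.
under [X in (_ + X)%E]eq_integral do rewrite fsym.
by rewrite -mule2n mule_natl.
Qed.

(** The integral is twice that of a continuous function over a compact segment, hence finite; later
    computations can then take place in [R]. *)
Lemma tent_integral_fin :
  (\int[mu]_t (f t * V (tent rho t))%:E = (fine (\int[mu]_t (f t * V (tent rho t))%:E))%:E)%E.
Proof.
rewrite fineK// tent_integral fin_numM// integrable_fin_num//.
apply: continuous_compact_integrable; first exact: segment_compact.
by apply: continuous_within_segment => t tar; apply: continuousM; [exact: cf|exact: cV].
Qed.

End Tent.

Section Cutoff.
Variables (rho del : R) (del0 : 0 < del) (drho : del < rho).

(** Only [[2 del, rho]] is kept, where the cutoff is at least [exp(-2)] and the tent is [t]. *)
Lemma cutoff_integral_ge (V : R -> R) : 2 * del < rho ->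
  (forall t, del <= t <= rho -> 0 <= V t) ->
  (\int[mu]_(t in `[(2 * del)%R, rho]) (expR (-1) ^+ 2 * V t)%:E <=
   \int[mu]_t (cutoff rho del t * V (tent rho t))%:E)%E.
Proof.
have dd : del <= 2 * del by rewrite ler_peMl ?(ltW del0)// ler1n.
move=> d2 V0; rewrite integral_mkcond; apply: le_integralT => t; rewrite patchE; case: ifPn => //.
- rewrite inE/= in_itv/= => /andP[t1 t2].
  by rewrite lee_fin mulr_ge0 ?sqr_ge0// V0// (le_trans dd t1).
- rewrite inE/= in_itv/= => /andP[t1 t2]; rewrite lee_fin tent_left//; apply: ler_wpM2r.
    by rewrite V0// (le_trans dd t1).
  by apply: cutoff_ge => //; rewrite t1/= (le_trans t2)//; lra.
- move=> _; rewrite lee_fin; apply: (@tent_ge0 del) => //.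
  + by move=> x; exact: cutoff_ge0.
  + by move=> x; exact: cutoff_out.
Qed.

(** The cutoff increases on [[del, rho]], so [|dcutoff| = dcutoff] there and integration by parts is
    exact. The boundary term at [del] vanishes; the one at [rho], doubled by the fold, is the whole
    Hardy difference. *)
Lemma dcutoff_integral (q : R) : 0 <= q ->
  (\int[mu]_t (`|dcutoff rho del t| * (tent rho t `^ q)^-1)%:E =
   q%:E * \int[mu]_t (cutoff rho del t * (tent rho t `^ (q + 1))^-1)%:E
   + (2 * (cutoff rho del rho * (rho `^ q)^-1))%:E)%E.
Proof.
move=> q0.
have pos t : del <= t <= rho -> 0 < t by move=> /andP[/(lt_le_trans del0)].
have cw p t : del <= t <= rho -> {for t, continuous (fun t => (t `^ p)^-1)}.
  by move=> /pos t0; exact: is_derive_continuous (is_derive_powRN p t0).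
have w0 p t : 0 <= (t `^ p)^-1 :> R by rewrite invr_ge0 powR_ge0.
rewrite (@tent_integral del rho (fun t => `|dcutoff rho del t|) (fun t => (t `^ q)^-1))//; first last.
- by move=> t; exact: cw.
- by move=> t; rewrite dcutoff_sym// normrN.
- by move=> t tout; rewrite dcutoff_out// normr0.
- by move=> t; apply: continuous_norm_fun; exact: continuous_dcutoff.
rewrite (@tent_integral del rho (cutoff rho del) (fun t => (t `^ (q + 1))^-1))//; first last.
- by move=> t; exact: cw.
- by move=> t; exact: cutoff_sym.
- by move=> t tout; rewrite cutoff_out.
- by move=> t; exact: is_derive_continuous (is_derive_cutoff rho del t).
- by move=> t; exact: cutoff_ge0.
have := @integration_by_parts R (fun t => (t `^ q)^-1) (cutoff rho del)
  (fun t => - (q * (t `^ (q + 1))^-1)) (dcutoff rho del) del rho drho.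
rewrite (@cutoff_out R rho del del0 del) ?ltxx// mulr0 subr0 => IBP.
have {}IBP : (\int[mu]_(t in `[del, rho]) ((t `^ q)^-1 * dcutoff rho del t)%:E =
    ((rho `^ q)^-1 * cutoff rho del rho)%:E
    - \int[mu]_(t in `[del, rho]) (- (q * (t `^ (q + 1))^-1) * cutoff rho del t)%:E)%E.
  apply: IBP.
  - by apply: continuous_within_segment => t tar; apply: continuousN; apply: continuousM;
      [exact: cvg_cst|exact: cw].
  - by apply: (is_derive_oo_LRcontinuous _ (ltW drho)) => t /pos; exact: is_derive_powRN.
  - by apply: is_derive_oo_derive1 => t /pos; exact: is_derive_powRN.
  - by apply: continuous_within_segment => t _; exact: continuous_dcutoff.
  - by apply: (is_derive_oo_LRcontinuous _ (ltW drho)) => t _; exact: is_derive_cutoff.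
  - by apply: is_derive_oo_derive1 => t _; exact: is_derive_cutoff.
have -> : (\int[mu]_(t in `[del, rho]) (`|dcutoff rho del t| * (t `^ q)^-1)%:E =
   \int[mu]_(t in `[del, rho]) ((t `^ q)^-1 * dcutoff rho del t)%:E)%E.
  apply: eq_integral => t; rewrite inE/= in_itv/= => /andP[_ tr].
  by rewrite ger0_norm ?dcutoff_ge0// mulrC.
rewrite IBP.
have -> : (\int[mu]_(t in `[del, rho]) (- (q * (t `^ (q + 1))^-1) * cutoff rho del t)%:E =
  - (q%:E * \int[mu]_(t in `[del, rho]) (cutoff rho del t * (t `^ (q + 1))^-1)%:E))%E.
  rewrite -ge0_integralZl_EFin//.
  - rewrite -integral_ge0N; last by move=> t _; rewrite -EFinM lee_fin mulr_ge0// mulr_ge0// cutoff_ge0.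
    by apply: eq_integral => t _; rewrite -EFinM -EFinN; congr EFin; ring.
  - by move=> t _; rewrite lee_fin mulr_ge0// cutoff_ge0.
  - apply/measurable_EFinP; apply: measurable_fun_segment => t tar.
    apply: continuousM; last exact: cw.
    exact: is_derive_continuous (is_derive_cutoff rho del t).
rewrite oppeK addeC muleDr// ?fin_num_adde_defl//.
congr (_ + _)%E; first by rewrite muleCA.
by rewrite -EFinM; congr EFin; rewrite [X in _ * X]mulrC.
Qed.

End Cutoff.
End CutoffIntegral.

(** * The product test functions and their integrals *)

Section Counterexample.
Variable R : realType.
Notation mu := (@lebesgue_measure R).

Lemma enorm_le_sum n (v : 'rV[R]_n) : enorm v <= \sum_(i < n) `|v 0 i|.
Proof.
have S0 : 0 <= \sum_(i < n) `|v 0 i| by exact: sumr_ge0.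
rewrite /enorm -[leRHS]ger0_norm// -sqrtr_sqr ler_wsqrtr// expr2 mulr_suml.
apply: ler_sum => i _; rewrite -real_normK ?num_real// expr2 ler_wpM2l//.
by rewrite (bigD1 i)//= lerDl sumr_ge0.
Qed.

Lemma grad_norm_le_sum n (u : 'rV[R]_n -> R) (x : 'rV[R]_n) :
  grad_norm u x <= \sum_(i < n) `|partial i u x|.
Proof.
have := enorm_le_sum (\row_i partial i u x).
by rewrite /enorm; under eq_bigr do rewrite mxE; under [leRHS]eq_bigr do rewrite mxE.
Qed.

(** At [gamma = 1] the antiderivative of [X^gamma / t] is [ln X] instead of a power of [X]. It is
    unbounded as [t] tends to 0, which is why the inequality fails. *)
Lemma is_derive_ln_Xf (r t : R) : 0 < t <= r ->
  is_derive t 1 (fun t => ln (Xf (t / r))) (t^-1 * Xf (t / r) `^ 1).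
Proof.
move=> t0r; have /andP[t0 tr] := t0r; have r0 : 0 < r by exact: lt_le_trans tr.
have X0 : 0 < Xf (t / r) by rewrite Xf_gt0 ?divr_gt0// ler_pdivrMr// mul1r.
have tr0 : 0 < t / r by rewrite divr_gt0.
have tr1 : t / r <= 1 by rewrite ler_pdivrMr// mul1r.
have D1 := @is_derive1_comp _ (@Xf R) (fun t => t / r) t _ _ (is_derive_Xf tr0 tr1) (is_derive_scale _ _).
have D2 := @is_derive1_comp _ (@ln R) _ t _ _ (is_derive1_ln X0) D1.
apply: is_derive_eq D2 _.
rewrite powRr1 ?(ltW X0)//; field.
by rewrite !lt0r_neq0.
Qed.

Definition logweight (r t : R) : R := t^-1 * Xf (t / r) `^ 1.

Lemma logweight_ge0 (r t : R) : 0 <= t -> 0 <= logweight r t.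
Proof. by move=> t0; rewrite mulr_ge0 ?invr_ge0 ?powR_ge0. Qed.

Lemma continuous_logweight (r t : R) : 0 < t <= r -> {for t, continuous (logweight r)}.
Proof.
move=> t0r; have /andP[t0 _] := t0r; apply: continuousM.
  by apply: continuousV; [exact: lt0r_neq0|exact: cvg_id].
exact: is_derive_continuous (is_derive_Xf_powR 1 t0r).
Qed.

Section Family.
Variables (m : nat) (r del L : R).
Hypotheses (del0 : 0 < del) (delr : 2 * del < r) (L2 : 2 < L).
Local Notation n := m.+2.

(** Midpoint and margin of the cutoff in coordinate [i]: the last factor is supported in
    [[del, 2r - del]], the others in [[1, 2L - 1]]. *)
Definition frho (i : 'I_n) : R := if i == ord_max then r else L.
Definition fdel (i : 'I_n) : R := if i == ord_max then del else 1.
Definition testfun (x : 'rV[R]_n) : R :=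
  \prod_(i < n) cutoff (frho i) (fdel i) (x 0 i).

Lemma fdel_gt0 i : 0 < fdel i. Proof. by rewrite /fdel; case: ifP. Qed.

Lemma fdel_lt i : fdel i < frho i.
Proof.
have d0 : 0 < del := del0; have dr : 2 * del < r := delr; have l2 : 2 < L := L2.
by rewrite /fdel /frho; case: ifP => _; lra.
Qed.

Lemma flat_alg_testfun : flat_alg testfun.
Proof.
(* The product is taken over an arbitrary list of indices so that induction applies. *)
suff H (s : seq 'I_n) :
  flat_alg (fun x => \prod_(i <- s) cutoff (frho i) (fdel i) (x 0 i)) by exact: H.
elim: s => [|i s IH].
  rewrite (_ : (fun x => _) = cst 1); first exact: flat_alg_cst.
  by apply/funext => x; rewrite big_nil.
rewrite (_ : (fun x => _) = (fun x : 'rV[R]_n => flat 1 ((fdel i)^-1 * x 0 i + -1)) *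
   (fun x => flat 1 (- (fdel i)^-1 * x 0 i + (2 * frho i / fdel i - 1))) *
   (fun x => \prod_(i <- s) cutoff (frho i) (fdel i) (x 0 i))).
  by apply: flat_algM => //; apply: flat_algM; exact: flat_alg_base.
by apply/funext => x; rewrite big_cons.
Qed.

Lemma testfun_neq0 x : testfun x != 0 ->
  forall i, fdel i < x 0 i < 2 * frho i - fdel i.
Proof.
move=> + i; apply: contraNT => /(cutoff_out (fdel_gt0 i)) ci.
by rewrite /testfun (bigD1 i)//= ci mul0r.
Qed.

(** The support lies in a compact box whose side in the last coordinate is [[del, 2r - del]], inside
    [(0, 2r)]. *)
Lemma testfun_Cc_inf : Cc_inf (strip n r) testfun.
Proof.
split; first exact: flat_alg_smooth flat_alg_testfun.
pose K : set 'rV[R]_n :=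
  [set v | forall i, `[fdel i, (2 * frho i - fdel i)]%classic (v ord0 i)].
have cK : compact K.
  by apply: (@rV_compact _ _ (fun i => `[fdel i, (2 * frho i - fdel i)]%classic)) => i;
    exact: segment_compact.
have sK : closure [set x | testfun x != 0] `<=` K.
  have /closure_id -> : closed K by apply: compact_closed => //; exact: norm_hausdorff.
  apply: closure_subset => x /= ux i; rewrite /= in_itv/=.
  by have /andP[/ltW -> /ltW ->] := testfun_neq0 ux i.
split; first exact: subclosed_compact (@closed_closure _ _) cK sK.
move=> x /sK /(_ ord_max); rewrite /= in_itv/= /fdel /frho eqxx => /andP[x1 x2].
by apply/andP; split; [exact: lt_le_trans x1|rewrite (le_lt_trans x2)// gtrBl].
Qed.

Lemma partial_testfun k x : partial k testfun x =
  \prod_(i < n) (if i == k then @dcutoff R else @cutoff R) (frho i) (fdel i) (x 0 i).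
Proof.
pose c := \prod_(i < n | i != k) cutoff (frho i) (fdel i) (x 0 i).
have D : is_derive (x 0 k) 1 (fun t => cutoff (frho k) (fdel k) t * c)
    (dcutoff (frho k) (fdel k) (x 0 k) * c).
  have := @is_deriveM _ _ _ (cst c) (x 0 k) 1 _ _
    (is_derive_cutoff (frho k) (fdel k) (x 0 k)) (is_derive_cst _ _ _).
  by rewrite scaler0 add0r [X in is_derive _ _ _ X -> _]mulrC.
have [|_] := @derive_along _ _ testfun x (evec R k) _ _ _ _ D.
  move=> h; rewrite /testfun (bigD1 k)//= !mxE eqxx mulr1; congr (_ * _).
  by apply: eq_bigr => i ik; rewrite !mxE eq_sym (negbTE ik) mulr0 add0r.
rewrite /partial => ->; rewrite [RHS](bigD1 k)//= eqxx; congr (_ * _).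
by apply: eq_bigr => i /negbTE ->.
Qed.

(* One factor of the product integrand: [b] selects [|cutoff^`()|] over [cutoff]. *)
Definition cutfactor (V : R -> R) (b : bool) (rho d t : R) : R :=
  (if b then `|dcutoff rho d t| else cutoff rho d t) * V (tent rho t).

Definition cutint (V : R -> R) (b : bool) (rho d : R) : R :=
  fine (\int[mu]_t (cutfactor V b rho d t)%:E)%E.

(** Nothing is asked at 0, so that weights singular at the boundary of the strip qualify. *)
Definition admissible (rho : R) (V : R -> R) :=
  forall t, 0 < t <= rho -> 0 <= V t /\ {for t, continuous V}.

Section CutFactor.
Variables (V : R -> R) (b : bool) (rho d : R).
Hypotheses (d0 : 0 < d) (drho : d < rho) (aV : admissible rho V).

Let f t := if b then `|dcutoff rho d t| else cutoff rho d t.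
Let f0 t : 0 <= f t. Proof. by rewrite /f; case: b => //; exact: cutoff_ge0. Qed.
Let cf t : {for t, continuous f}.
Proof.
rewrite /f; case: b; first by apply: continuous_norm_fun; exact: continuous_dcutoff.
exact: is_derive_continuous (is_derive_cutoff rho d t).
Qed.
Let fout t : ~~ (d < t < 2 * rho - d) -> f t = 0.
Proof. by move=> h; rewrite /f; case: b; rewrite ?dcutoff_out ?cutoff_out ?normr0. Qed.
Let fsym t : f (2 * rho - t) = f t.
Proof. by rewrite /f; case: b; rewrite ?dcutoff_sym ?normrN// cutoff_sym. Qed.
Let pos t : d <= t <= rho -> 0 < t <= rho.
Proof. by move=> /andP[/(lt_le_trans d0) -> ->]. Qed.
Let V0 t : d <= t <= rho -> 0 <= V t. Proof. by move=> /pos /aV[]. Qed.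
Let cV t : d <= t <= rho -> {for t, continuous V}. Proof. by move=> /pos /aV[]. Qed.

Lemma cutfactor_ge0 t : 0 <= cutfactor V b rho d t.
Proof. exact: (tent_ge0 f0 fout V0). Qed.

Lemma measurable_cutfactor : measurable_fun setT (cutfactor V b rho d).
Proof. exact: (tent_measurable cf fout cV). Qed.

Lemma cutint_integral :
  (\int[mu]_t (cutfactor V b rho d t)%:E = (cutint V b rho d)%:E)%E.
Proof. exact: (tent_integral_fin drho f0 cf fout fsym V0 cV). Qed.

Lemma cutint_ge0 : 0 <= cutint V b rho d.
Proof.
by rewrite -lee_fin -cutint_integral; apply: integral_ge0 => t _; rewrite lee_fin cutfactor_ge0.
Qed.

End CutFactor.

Lemma admissible_cst1 rho : admissible rho (cst 1).
Proof. by move=> t _; split => //; exact: cvg_cst. Qed.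

Lemma admissible_powRV rho q : admissible rho (fun t => (t `^ q)^-1).
Proof.
move=> t /andP[t0 _]; split; first by rewrite invr_ge0 powR_ge0.
exact: is_derive_continuous (is_derive_powRN q t0).
Qed.

Lemma admissible_logweight rho : admissible rho (logweight rho).
Proof.
move=> t t0; split; last exact: continuous_logweight.
by apply: logweight_ge0; case/andP: t0 => /ltW.
Qed.

Section FamilyIntegral.
Variables (V : R -> R) (aV : admissible r V).

(** The distance to the boundary depends on the last coordinate only, so only that factor carries
    the weight. *)
Definition fweight (i : 'I_n) : R -> R := if i == ord_max then V else cst 1.

Lemma admissible_fweight i : admissible (frho i) (fweight i).
Proof. by rewrite /frho /fweight; case: ifP => _ //; exact: admissible_cst1. Qed.

Definition ffactor b i t := cutfactor (fweight i) b (frho i) (fdel i) t.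
Definition fint b i := cutint (fweight i) b (frho i) (fdel i).

Lemma prod_ffactor (x : 'rV[R]_n) (b : 'I_n -> bool) :
  \prod_(i < n) ffactor (b i) i (x 0 i) =
  (\prod_(i < n) if b i then `|dcutoff (frho i) (fdel i) (x 0 i)| else cutoff (frho i) (fdel i) (x 0 i))
  * V (tent r (x 0 ord_max)).
Proof.
rewrite big_split/=; congr (_ * _).
rewrite (bigD1 ord_max)//= big1 ?mulr1; last by move=> i /negbTE iN; rewrite /fweight iN.
by rewrite /fweight /frho eqxx.
Qed.

Lemma lebn_testfun :
  lebn_on (strip n r) (fun x => (testfun x * V (dS r x))%:E) =
  (\prod_(i < n) fint false i)%:E.
Proof.
pose h (k : 'I_1) i t := ffactor false i t.
transitivity (lebn (fun x : 'rV[R]_n => (\sum_(k < 1) 1 * \prod_(i < n) h k i (x 0 i))%:E)).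
  congr lebn; apply/funext => x; rewrite big_ord1 mul1r (prod_ffactor x (fun=> false)).
  case: ifPn; first by rewrite inE => xs; rewrite dS_tent.
  rewrite notin_setE => xs; congr EFin; rewrite [\prod_(i < _) _](_ : _ = testfun x)//.
  rewrite (_ : testfun x = 0) ?mul0r//; apply: contra_notP xs => /eqP /testfun_neq0 /(_ ord_max).
  rewrite /fdel /frho eqxx => /andP[x1 x2].
  by apply/andP; split; [exact: lt_trans x1|rewrite (lt_trans x2)// gtrBl].
rewrite (lebn_sum_prod (I := fun k i => fint false i))// ?big_ord1 ?mul1r//.
- by move=> k i t; apply: cutfactor_ge0; [exact: fdel_gt0|exact: admissible_fweight].
- by move=> k i; apply: measurable_cutfactor; [exact: fdel_gt0|exact: admissible_fweight].
- by move=> k i; apply: cutint_integral; [exact: fdel_gt0|exact: fdel_lt|exact: admissible_fweight].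
Qed.

(** The gradient norm is at most the sum of the [|partial k testfun|], each a product with the
    cutoff differentiated in place [k] alone. *)
Lemma lebn_grad_testfun :
  (lebn_on (strip n r) (fun x => (grad_norm testfun x * V (dS r x))%:E) <=
  (\sum_(k < n) \prod_(i < n) fint (i == k) i)%:E)%E.
Proof.
pose h (k i : 'I_n) t := ffactor (i == k) i t.
have h0 k i t : 0 <= h k i t.
  by apply: cutfactor_ge0; [exact: fdel_gt0|exact: admissible_fweight].
have -> : \sum_(k < n) \prod_(i < n) fint (i == k) i =
  \sum_(k < n) 1 * \prod_(i < n) fint (i == k) i by under [RHS]eq_bigr do rewrite mul1r.
rewrite -(lebn_sum_prod (c := fun=> 1) (h := h) (I := fun k i => fint (i == k) i))//; first last.
- by move=> k i; apply: cutint_integral; [exact: fdel_gt0|exact: fdel_lt|exact: admissible_fweight].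
- by move=> k i; apply: measurable_cutfactor; [exact: fdel_gt0|exact: admissible_fweight].
have VdS x : strip n r x -> 0 <= V (dS r x).
  move=> xs; rewrite dS_tent//; have [] // := @aV (tent r (x 0 ord_max)).
  have /andP[x1 x2] : 0 < x 0 ord_max < 2 * r := xs.
  by rewrite /tent lt_min ge_min; apply/andP; split; lra.
apply: le_lebn => x.
  by case: ifPn => //; rewrite inE => xs; rewrite lee_fin mulr_ge0 ?sqrtr_ge0 ?VdS.
case: ifPn => [|_]; last by rewrite lee_fin sumr_ge0// => k _; rewrite mul1r prodr_ge0.
rewrite inE => xs; rewrite lee_fin.
under [leRHS]eq_bigr do rewrite mul1r prod_ffactor.
rewrite -mulr_suml -dS_tent// ler_wpM2r ?VdS//.
apply: (le_trans (grad_norm_le_sum _ _)); apply: ler_sum => k _.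
rewrite partial_testfun normr_prod; apply: ler_prod => i _; rewrite normr_ge0/=.
by case: ifP => // _; rewrite ger0_norm ?cutoff_ge0.
Qed.

Lemma fint_lift b (j : 'I_m.+1) : fint b (widen_ord (leqnSn m.+1) j) = cutint (cst 1) b L 1.
Proof.
have E : (widen_ord (leqnSn m.+1) j == ord_max) = false.
  by rewrite -val_eqE /= ltn_eqF.
by rewrite /fint /fweight /frho /fdel E.
Qed.

Lemma fint_max b : fint b ord_max = cutint V b r del.
Proof. by rewrite /fint /fweight /frho /fdel eqxx. Qed.

Lemma prod_fint : \prod_(i < n) fint false i = cutint (cst 1) false L 1 ^+ m.+1 * cutint V false r del.
Proof.
rewrite big_ord_recr/= fint_max; congr (_ * _).
by under eq_bigr do rewrite fint_lift; rewrite prodr_const card_ord.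
Qed.

(** The [m.+1] tangential derivatives contribute equally; the last summand is the normal
    derivative. *)
Lemma sum_prod_fint : \sum_(k < n) \prod_(i < n) fint (i == k) i =
  (cutint (cst 1) true L 1 * cutint (cst 1) false L 1 ^+ m * cutint V false r del) *+ m.+1
  + cutint (cst 1) false L 1 ^+ m.+1 * cutint V true r del.
Proof.
rewrite big_ord_recr/=; congr (_ + _).
  rewrite -[RHS]/(_ *+ m.+1) -[in RHS](card_ord m.+1) -sumr_const; apply: eq_bigr => k _.
  rewrite big_ord_recr/= fint_max [ord_max == _]eq_sym -val_eqE /= ltn_eqF//; congr (_ * _).
  under eq_bigr do rewrite fint_lift -val_eqE /=.
  rewrite (bigD1 k)//= eqxx; congr (_ * _).
  under eq_bigr => i ik do rewrite val_eqE (negbTE ik).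
  by rewrite prodr_const cardC1 card_ord.
rewrite big_ord_recr/= eqxx fint_max; congr (_ * _).
under eq_bigr => i _ do rewrite fint_lift -val_eqE /= ltn_eqF//.
by rewrite prodr_const card_ord.
Qed.

End FamilyIntegral.

End Family.
End Counterexample.

(** * Choice of the parameters and the contradiction *)

Section Optimality.
Variable R : realType.
Notation mu := (@lebesgue_measure R).

Lemma cutint_grad (s r del : R) : 1 <= s -> 0 < del -> del < r ->
  cutint (fun t => (t `^ (s - 1))^-1) true r del =
  (s - 1) * cutint (fun t => (t `^ s)^-1) false r del
  + 2 * (cutoff r del r * (r `^ (s - 1))^-1).
Proof.
move=> s1 d0 dr; apply: EFin_inj; rewrite -cutint_integral//; last exact: admissible_powRV.
rewrite /cutfactor dcutoff_integral ?subr_ge0// subrK [RHS]EFinD; congr (_ + _)%E.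
by rewrite EFinM -cutint_integral//; exact: admissible_powRV.
Qed.

(** The case [s = 1] of the preceding identity: the total variation is twice the value at the
    midpoint, hence bounded independently of [L]. *)
Lemma cutint_cst_grad_le2 (L : R) : 1 < L -> cutint (cst 1) true L 1 <= 2.
Proof.
move=> L1; have := @cutint_grad 1 L 1 (lexx _) ltr01 L1.
rewrite subrr mul0r add0r powRr0 invr1 mulr1.
have -> : (fun t : R => (t `^ 0)^-1) = cst 1 by apply/funext => t; rewrite powRr0 invr1.
by move=> ->; rewrite -[leRHS]mulr1 ler_wpM2l// cutoff_le1.
Qed.

Lemma cutint_cst_ge (L : R) : 2 < L ->
  expR (-1) ^+ 2 * (L - 2) <= cutint (cst 1) false L 1.
Proof.
move=> L2; have L1 : 1 < L by lra.
have L21 : 2 * 1 < L by rewrite mulr1.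
have := @cutoff_integral_ge R L 1 ltr01 (cst 1) L21 (fun _ _ => ler01).
have cc : forall x : R, {for x, continuous (fun t : R => expR (-1) ^+ 2 * cst 1 t : R)}.
  move=> x; apply: continuousM; exact: cvg_cst.
have -> := @integral_derive R (2 * 1) L (fun t => t * (expR (-1) ^+ 2 * 1))
  (fun t => expR (-1) ^+ 2 * cst 1 t) L21 (fun t _ => is_derive_scale _ t) (fun t _ => cc t).
rewrite (cutint_integral false ltr01 L1 (@admissible_cst1 R L)).
by rewrite lee_fin => h; apply: le_trans h; rewrite !mulr1 -mulrBl mulrC.
Qed.

(** [del] is chosen so that [2 del / r = exp(1 - exp M)], that is [X(2 del / r) = exp(-M)]. The
    integral of [X(t/r) / t] over [[2 del, r]] is then exactly [M]. *)
Lemma cutint_logweight_ge (r M : R) (del := r / 2 * expR (1 - expR M)) : 0 < r -> 0 < M ->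
  expR (-1) ^+ 2 * M <= cutint (logweight r) false r del.
Proof.
move=> r0 M0.
have e1 : expR (1 - expR M) < 1 by rewrite expR_lt1 subr_lt0 expR_gt1.
have e0 := expR_gt0 (1 - expR M).
have d2 : 2 * del = r * expR (1 - expR M) by rewrite /del; field.
have d2r : 2 * del < r by rewrite d2 gtr_pMr.
have d0 : 0 < del by rewrite mulr_gt0// divr_gt0.
have dr : del < r by lra.
have pos t : 2 * del <= t <= r -> 0 < t <= r.
  by move=> /andP[t1 ->]; rewrite (lt_le_trans _ t1)// mulr_gt0.
have V0 t : del <= t <= r -> 0 <= logweight r t.
  by move=> /andP[t1 _]; rewrite logweight_ge0// (le_trans _ t1)// ltW.
have := cutoff_integral_ge d0 d2r V0.
have -> : (\int[mu]_(t in `[(2 * del)%R, r]) (expR (-1) ^+ 2 * logweight r t)%:E =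
    (ln (Xf (r / r)) * expR (-1) ^+ 2 - ln (Xf (2 * del / r)) * expR (-1) ^+ 2)%R%:E)%E.
  apply: (@integral_derive R _ _ (fun t => ln (Xf (t / r)) * expR (-1) ^+ 2)) => // t /pos tr; last first.
    by apply: continuousM; [exact: cvg_cst|exact: continuous_logweight].
  have := @is_deriveM _ _ _ (cst (expR (-1) ^+ 2)) t 1 _ _ (is_derive_ln_Xf tr) (is_derive_cst _ _ _).
  by rewrite scaler0 add0r.
rewrite (cutint_integral false d0 dr (@admissible_logweight R r)).
rewrite lee_fin => h; apply: le_trans h.
have rr : r / r = 1 by rewrite divff ?lt0r_neq0.
rewrite rr Xf1 ln1 mul0r sub0r.
have -> : 2 * del / r = expR (1 - expR M) by rewrite d2; field; rewrite lt0r_neq0.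
by rewrite /Xf expRK opprB addrC subrK -expRN expRK mulNr opprK mulrC.
Qed.

Lemma hardy_strip_optimal m (r s : R) : 0 < r -> 1 <= s ->
  ~ exists C : R, 0 < C /\
    forall u : 'rV[R]_m.+2 -> R, Cc_inf (strip m.+2 r) u ->
      (lebn_on (strip m.+2 r) (fun x => (grad_norm u x / dS r x `^ (s - 1))%:E)
       >= (s - 1)%:E * lebn_on (strip m.+2 r) (fun x => (`|u x| / dS r x `^ s)%:E)
          + (C / r `^ (s - 1))%:E *
            lebn_on (strip m.+2 r)
              (fun x => (`|u x| / dS r x * Xf (dS r x / r) `^ 1)%:E))%E.
Proof.
move=> r0 s1 [C [C0 H]].
pose e := expR (-1) ^+ 2 : R.
have e0 : 0 < e by rewrite exprn_gt0// expR_gt0.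
(* This value gives [C * a2 >= 3], which exceeds the boundary contribution [2 * phi <= 2] by at
   least 1. *)
pose M := 3 / (C * e); have M0 : 0 < M by rewrite divr_gt0// mulr_gt0.
have /= := cutint_logweight_ge r0 M0; set del := r / 2 * _ => a2M.
have d0 : 0 < del by rewrite mulr_gt0 ?divr_gt0 ?expR_gt0.
have d2r : 2 * del < r.
  have e1 : expR (1 - expR M) < 1 by rewrite expR_lt1 subr_lt0 expR_gt1.
  by rewrite (_ : 2 * del = r * expR (1 - expR M)); [rewrite gtr_pMr|rewrite /del; field].
have dr : del < r by lra.
pose q := (r `^ (s - 1))^-1; have q0 : 0 < q by rewrite invr_gt0 powR_gt0.
pose a0 := cutint (fun t => (t `^ (s - 1))^-1) false r del.
pose a1 := cutint (fun t => (t `^ s)^-1) false r del.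
pose a2 := cutint (logweight r) false r del.
have a00 : 0 <= a0 by apply: cutint_ge0 => //; exact: admissible_powRV.
(* As [E >= e (L - 2)], this makes [q * E] at least [4 (m+1) a0 + 1], more than the tangential
   contribution [(m+1) D a0 <= 2 (m+1) a0]. *)
pose L := 2 + (4 * m.+1%:R * a0 + 1) / (q * e).
have L2 : 2 < L by rewrite ltrDl divr_gt0 ?mulr_gt0// ltr_wpDl// !mulr_ge0.
have L1 : 1 < L by lra.
pose E := cutint (cst 1) false L 1.
have EL : (4 * m.+1%:R * a0 + 1) <= q * E.
  have LE : L - 2 = (4 * m.+1%:R * a0 + 1) / (q * e) by rewrite /L addrAC subrr add0r.
  have := cutint_cst_ge L2; rewrite -/E -/e LE => h.
  have := ler_wpM2l (ltW q0) h; congr (_ <= _); field.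
  by rewrite !lt0r_neq0.
have E0 : 0 < E.
  by rewrite -(pmulr_rgt0 _ q0) (lt_le_trans _ EL)// ltr_wpDl// !mulr_ge0.
pose D := cutint (cst 1) true L 1.
have D2 : D <= 2 by exact: cutint_cst_grad_le2.
have := H _ (@testfun_Cc_inf R m r del L d0).
have u0 (x : 'rV[R]_m.+2) : 0 <= testfun r del L x.
  by apply: prodr_ge0 => i _; exact: cutoff_ge0.
have -> : (fun x => (`|testfun r del L x| / dS r x `^ s)%:E) =
    (fun x : 'rV[R]_m.+2 => (testfun r del L x * (fun t => (t `^ s)^-1) (dS r x))%:E).
  by apply/funext => x; rewrite ger0_norm.
have -> : (fun x => (`|testfun r del L x| / dS r x * Xf (dS r x / r) `^ 1)%:E) =
    (fun x : 'rV[R]_m.+2 => (testfun r del L x * logweight r (dS r x))%:E).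
  by apply/funext => x; rewrite ger0_norm// -mulrA.
rewrite (lebn_testfun m d0 d2r L2 (@admissible_powRV R r s)).
rewrite (lebn_testfun m d0 d2r L2 (@admissible_logweight R r)).
move=> /le_trans /(_ (lebn_grad_testfun m d0 d2r L2 (@admissible_powRV R r (s - 1)))).
rewrite !prod_fint sum_prod_fint -/a0 -/a1 -/a2 -/E -/D cutint_grad// -/a1 -/q.
rewrite -!EFinM -EFinD lee_fin.
set phi := cutoff r del r => ineq.
have phi1 : phi <= 1 by exact: cutoff_le1.
have Ca2 : 3 <= C * a2.
  have := ler_wpM2l (ltW C0) a2M; rewrite -/e -/a2 (_ : C * (e * M) = 3)// /M; field.
  by rewrite !lt0r_neq0.
have p0 : 0 < E ^+ m by exact: exprn_gt0.
(* The terms with [(s - 1) a1] cancel on both sides, and the common factor [E ^+ m] is divided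
   out. *)
have {ineq} : (C * a2 - 2 * phi) * (q * E) <= m.+1%:R * (D * a0).
  rewrite -(ler_pM2l p0) -subr_ge0; move: ineq.
  by rewrite -subr_ge0 -/q exprS -mulr_natl; congr (_ <= _); ring.
apply/negP; rewrite -ltNge.
have h1 : m.+1%:R * (D * a0) <= m.+1%:R * (2 * a0) by rewrite ler_wpM2l// ler_wpM2r.
apply: (le_lt_trans h1); apply: (@lt_le_trans _ _ (1 * (q * E))); last first.
  by rewrite ler_wpM2r ?mulr_ge0 ?(ltW q0) ?(ltW E0)//; lra.
rewrite mul1r; apply: lt_le_trans EL.
have : 0 <= m.+1%:R * a0 by rewrite mulr_ge0.
by lra.
Qed.

End Optimality.

Theorem theoremD (R : realType) (n : nat) (hn : (2 <= n)%N) (r : R) (hr : 0 < r) :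
  (forall (s gamma : R), 1 <= s -> 1 < gamma ->
     exists C : R, gamma - 1 <= C /\
       forall u : 'rV[R]_n -> R, Cc_inf (strip n r) u ->
         (lebn_on (strip n r) (fun x => (grad_norm u x / dS r x `^ (s - 1))%:E)
          >= (s - 1)%:E * lebn_on (strip n r) (fun x => (`|u x| / dS r x `^ s)%:E)
             + (C / r `^ (s - 1))%:E *
               lebn_on (strip n r)
                 (fun x => (`|u x| / dS r x * Xf (dS r x / r) `^ gamma)%:E))%E)
  /\
  (forall s : R, 1 <= s ->
     ~ exists C : R, 0 < C /\
       forall u : 'rV[R]_n -> R, Cc_inf (strip n r) u ->
         (lebn_on (strip n r) (fun x => (grad_norm u x / dS r x `^ (s - 1))%:E)
          >= (s - 1)%:E * lebn_on (strip n r) (fun x => (`|u x| / dS r x `^ s)%:E)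
             + (C / r `^ (s - 1))%:E *
               lebn_on (strip n r)
                 (fun x => (`|u x| / dS r x * Xf (dS r x / r) `^ 1)%:E))%E).
Proof.
case: n hn => [|[|m]]// _; split=> [s gamma s1 g1|s s1]; last exact: hardy_strip_optimal.
by exists (gamma - 1); split=> // u uC; exact: hardy_strip_part1.
Qed.
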